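(* Let $X$ be a nonempty Hausdorff compact space, let $\alpha:X\to X$ be a continuous mapping, and let $A:C(X)\to C(X)$ be a transfer operator for $(X,\alpha)$, with spectral potential $\lambda(\varphi)$ and $t$-entropy $\tau(\mu)$. Then $$\lambda(\varphi)=\max_{\mu\in M_\alpha}\bigl(\mu(\varphi)+\tau(\mu)\bigr)\qquad\text{for every }\varphi\in C(X),$$ and $$\tau(\mu)=\inf_{\varphi\in C(X)}\bigl(\lambda(\varphi)-\mu(\varphi)\bigr)\qquad\text{for every }\mu\in M_\alpha.$$
   Context: $C(X)$ is the algebra of continuous real-valued functions on $X$ with the uniform norm; $\mathbf 1$ is the unit function. A linear operator $A:C(X)\to C(X)$ is a transfer operator for $(X,\alpha)$ if it is positive (maps nonnegative functions to nonnegative functions) and satisfies the homological identity $A\bigl((f\circ\alpha)\,g\bigr)=f\,Ag$ for all $f,g\in C(X)$. For $\varphi\in C(X)$ put $A_\varphi f:=A(e^{\varphi}f)$. The spectral potential $\lambda(\varphi)$ is the logarithm of the spectral radius of $A_\varphi$: $$\lambda(\varphi)=\lim_{n\to\infty}\frac1n\ln\|A_\varphi^n\|=\lim_{n\to\infty}\frac1n\ln\|A_\varphi^n\mathbf 1\|\in[-\infty,\infty),\qquad \ln 0=-\infty.$$ $M$ is the set of all positive linear functionals $\mu$ on $C(X)$ with $\mu(\mathbf 1)=1$ (identified with regular Borel probability measures on $X$); $M_\alpha$ is the set of $\mu\in M$ with $\mu(f\circ\alpha)=\mu(f)$ for all $f\in C(X)$. A partition of unity in $C(X)$ is a finite set $D=\{g_1,\dots,g_k\}$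 of nonnegative functions in $C(X)$ with $g_1+\dots+g_k\equiv 1$. The $t$-entropy is the functional $\tau$ on $M_\alpha$ given by $$\tau(\mu):=\inf_{n\in\mathbb N}\frac{\tau_n(\mu)}{n},\qquad \tau_n(\mu):=\inf_D\tau_n(\mu,D),\qquad \tau_n(\mu,D):=\sup_{m\in M}\sum_{g\in D}\mu(g)\ln\frac{m(A^ng)}{\mu(g)},$$ where the infimum is over all partitions of unity $D$ in $C(X)$; a summand with $\mu(g)=0$ is set to be zero regardless of $m(A^ng)$; and if for some $g\in D$ one has $A^ng\equiv0$ and $\mu(g)>0$, then $\tau(\mu)=-\infty$ (consistently with $\ln0=-\infty$). *)

(* Defs.v *)
From HB Require Import structures.
From mathcomp Require Import all_boot all_order all_algebra.
From mathcomp Require Import all_classical all_reals all_analysis.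

Set Implicit Arguments.
Unset Strict Implicit.
Unset Printing Implicit Defensive.

Import Order.TTheory GRing.Theory Num.Theory.
Import numFieldNormedType.Exports.

Local Open Scope classical_set_scope.
Local Open Scope ring_scope.

(* The algebra C(X): the library's bundled continuous functions, equipped below
   with the pointwise commutative ring and R-module structures, as a subtype of
   [X -> R].  The possibly-zero ring structure is used because [X] is only
   assumed nonempty in theorems, so 1 != 0 cannot be inferred from its type. *)
Notation Cfun X R := (continuousType X R).

Definition cfun (X : topologicalType) (R : realType) : {pred X -> R} :=
  mem [set f : X -> R | continuous f].

Section cfun_sub.
Context (X : topologicalType) (R : realType).
Notation T := (Cfun X R).

Section Sub.
Context (f : X -> R) (fP : f \in @cfun X R).
Definition cfun_Sub : T := mkcts (set_mem fP).
End Sub.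

Lemma cfun_rect (K : T -> Type) :
  (forall f (Pf : f \in @cfun X R), K (cfun_Sub Pf)) -> forall u : T, K u.
Proof.
move=> Ksub u; have uP : (u : X -> R) \in @cfun X R.
  by rewrite inE; exact: cts_fun.
by have := Ksub _ uP; rewrite (_ : cfun_Sub uP = u)//; exact/continuousEP.
Qed.

Lemma cfun_valP f (Pf : f \in @cfun X R) : cfun_Sub Pf = f :> (X -> R).
Proof. by []. Qed.

HB.instance Definition _ := isSub.Build (X -> R) _ T cfun_rect cfun_valP.

Lemma cfun_subring_closed : subring_closed (@cfun X R).
Proof.
split=> [|f g|f g]; rewrite !inE/=.
- by move=> x; exact: cvg_cst.
- by move=> cf cg x; apply: continuousB; [exact: cf|exact: cg].
- by move=> cf cg x; apply: continuousM; [exact: cf|exact: cg].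
Qed.

HB.instance Definition _ :=
  GRing.isSubringClosed.Build _ (@cfun X R) cfun_subring_closed.

HB.instance Definition _ := GRing.SubChoice_isSubComPzRing.Build _ _ T (subringClosedP _).

Lemma cfun_scaler_closed : scaler_closed (@cfun X R).
Proof.
move=> a f; rewrite !inE => cf x.
by apply: continuousM; [exact: cvg_cst|exact: cf].
Qed.

HB.instance Definition _ :=
  GRing.isScaleClosed.Build _ _ (@cfun X R) cfun_scaler_closed.

HB.instance Definition _ := [SubZmodule_isSubLmodule of T by <:].

Implicit Types f g : T.

Lemma cfun0E : (0 : T) = cst 0 :> (X -> R). Proof. by []. Qed.
Lemma cfun1E : (1 : T) = cst 1 :> (X -> R). Proof. by []. Qed.
Lemma cfunDE f g : (f + g : T) = (fun x => f x + g x) :> (X -> R).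
Proof. by []. Qed.
Lemma cfunME f g : (f * g : T) = (fun x => f x * g x) :> (X -> R).
Proof. by []. Qed.
Lemma cfunZE a f : (a *: f : T) = (fun x => a * f x) :> (X -> R).
Proof. by []. Qed.

End cfun_sub.

HB.instance Definition _ (R : realType) :=
  @isContinuous.Build R R expR (@continuous_expR R).

Section t_entropy.
Context {X : topologicalType} {R : realType}.
Implicit Types (f g phi : Cfun X R) (mu m : {scalar Cfun X R}).

Definition cnonneg f := forall x, 0 <= f x.

(* The norms are suprema in [\bar R], so that an unbounded set of values gives
   [+oo] and not a default value. *)
Definition unorm f : \bar R := ereal_sup (range (fun x => `|f x|%:E)).

Definition opnorm (T : Cfun X R -> Cfun X R) : \bar R :=
  ereal_sup [set unorm (T f) | f in [set f | (unorm f <= 1)%E]].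

Definition transfer_operator (alpha : continuousType X X)
    (A : {linear Cfun X R -> Cfun X R}) : Prop :=
  (forall f, cnonneg f -> cnonneg (A f)) /\
  (forall f g, A ((f \o alpha : Cfun X R) * g) = f * A g).

Definition weighted (A : {linear Cfun X R -> Cfun X R}) phi :
    Cfun X R -> Cfun X R :=
  fun f => A ((expR \o phi : Cfun X R) * f).

(* Logarithm of the spectral radius, with [lne 0 = -oo].  The term of index 0 is
   0 and plays no role.  For a transfer operator on a nonempty compact space the
   sequence converges in [\bar R] because [n |-> opnorm (iter n _)] is
   submultiplicative. *)
Definition spectral_potential (A : {linear Cfun X R -> Cfun X R}) phi :
    \bar R :=
  limn (fun n => (n%:R^-1)%:E * lne (opnorm (iter n (weighted A phi))))%E.

(* M, as positive normalized linear functionals; continuity is automatic. *)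
Definition states : set {scalar Cfun X R} :=
  [set mu | (forall f, cnonneg f -> 0 <= mu f) /\ mu 1 = 1].

Definition invariant_states (alpha : continuousType X X) :
    set {scalar Cfun X R} :=
  [set mu | states mu /\ forall f, mu (f \o alpha : Cfun X R) = mu f].

Definition partition_of_unity : set (set (Cfun X R)) :=
  [set D | [/\ finite_set D, (forall g, D g -> cnonneg g) &
               \sum_(g \in D) g = 1]].

Section tau.
Variable A : {linear Cfun X R -> Cfun X R}.

(* [m (iter n A g)] may be 0, and then the summand is [-oo]. No summand is ever
   [+oo] when [mu] and [m] are states, so the sums below are unambiguous. *)
Definition tau_term n mu m g : \bar R :=
  if mu g == 0 then 0%E
  else ((mu g)%:E * lne (m (iter n A g) / mu g)%:E)%E.

Definition tau_nD n mu (D : set (Cfun X R)) : \bar R :=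
  ereal_sup [set (\sum_(g \in D) tau_term n mu m g)%E | m in states].

Definition tau_n n mu : \bar R :=
  ereal_inf [set tau_nD n mu D | D in partition_of_unity].

Definition t_entropy mu : \bar R :=
  ereal_inf [set ((n%:R^-1)%:E * tau_n n mu)%E | n in [set n | (0 < n)%N]].

End tau.

End t_entropy.

(* Main.v *)
(* For r real, say that phi grows at rate at most r if A^n(exp(S_n phi)) <= C exp(n r) for
   some C and all n, where S_n phi is the Birkhoff sum. Submultiplicativity makes lambda(phi)
   the infimum of these rates, which is monotone, convex, translation equivariant, and
   invariant under adding coboundaries.
   Upper bound tau(mu) <= lambda(phi) - mu(phi): take a partition D on whose supports S_n phi
   oscillates by at most 2 and apply Jensen's inequality; the error disappears after
   division by n.
   Lower bound tau(mu) >= inf_phi (lambda(phi) - mu(phi)): given n and D, the first-order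
   optimality condition for the concave maximization over m defining tau_n(mu, D) produces
   positive weights a_g with A^n(sum a_g g) <= 1 and - sum mu(g) ln a_g <= tau_n(mu, D), up to
   small errors. By Jensen's inequality psi = sum (ln a_g) g satisfies A^n(exp psi) <= 1, and
   convexity, with the identity A^i((f o alpha^i) g) = f A^i g, turns this into
   lambda(psi / n) <= 0.
   The maximum is attained at a Hahn-Banach subgradient of lambda at phi, which is an
   invariant state by the properties of lambda listed above. If lambda(phi) = -oo, any
   invariant state will do, and the same subgradient argument applied to the identity
   operators in place of the A^n provides one. *)
From HB Require Import structures.
Require Import Defs.
From mathcomp Require Import all_boot all_order all_algebra.
From mathcomp Require Import all_classical all_reals all_analysis.
From mathcomp Require Import ring lra.
Import Order.TTheory GRing.Theory Num.Theory.
Import numFieldNormedType.Exports.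
Local Open Scope classical_set_scope.
Local Open Scope ring_scope.

(** * Hahn-Banach extension through maximal convex cones *)

Section hahn_banach.
Context {R : realType} {V : lmodType R}.
Implicit Types (C : set (V * R)).

Definition cone C :=
  (forall u v, C u -> C v -> C (u + v)) /\
  (forall t u, 0 < t -> C u -> C (t *: u)).

(** Zorn's lemma is applied to sets [C] through the condition on the union of [C0] and [C], so that
    the empty chain, whose union is empty, is covered by [C0] itself. *)
Lemma maximal_cone C0 w : cone C0 -> ~ C0 w -> exists C,
  [/\ cone C, C0 `<=` C, ~ C w &
    forall D, cone D -> C `<=` D -> ~ D w -> D `<=` C].
Proof.
move=> [addC0 scaleC0] C0w.
pose P C := cone (C0 `|` C) /\ ~ (C0 `|` C) w.
have [F FP Ftot|C [[cC Cw] maxC]] := @Zorn_bigcup _ P.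
  split; last by move=> [//|[C /FP[_ h] Cw]]; apply: h; right.
  have [->|/set0P[C1 FC1]] := eqVneq F set0; first by rewrite bigcup_set0 setU0.
  have memU C u : F C -> (C0 `|` C) u -> (C0 `|` \bigcup_(D in F) D) u.
    by move=> FC [|Cu]; [left|right; exists C].
  have step u : (C0 `|` \bigcup_(D in F) D) u -> exists2 C, F C & (C0 `|` C) u.
    by move=> [C0u|[C FC Cu]]; [exists C1 => //; left|exists C => //; right].
  split=> [u v /step[C FC Cu] /step[D FD Dv]|t u t0 /step[C FC Cu]]; last first.
    by apply: (memU C) => //; apply: (FP _ FC).1.2.
  have [CD|DC] := Ftot _ _ FC FD.
    apply: (memU D) => //; apply: (FP _ FD).1.1 => //.
    by case: Cu => [|/CD]; [left|right].
  apply: (memU C) => //; apply: (FP _ FC).1.1 => //.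
  by case: Dv => [|/DC]; [left|right].
exists (C0 `|` C); split=> // D cD CD Dw.
have CD' : C `<=` D by move=> u Cu; apply: CD; right.
have C0D : C0 `|` D = D by apply/seteqP; split=> [u [C0u|//]|u ?]; [apply: CD; left|right].
move=> u Du; apply: contrapT => nu.
have /maxC : C `<` D by split=> // DC; apply: nu; right; exact: DC.
by apply; split; rewrite C0D.
Qed.

(* The cone is thought of as the epigraph of a sublinear functional. *)
Lemma dominated_extension C0 : cone C0 -> ~ C0 (0, -1) ->
    (forall t, 0 < t -> C0 (0, t)) -> (forall x, exists r, C0 (x, r)) ->
  exists m : {scalar V}, forall x r, C0 (x, r) -> m x <= r.
Proof.
move=> cC0 C0w C0pos C0tot.
have [C [[addC scaleC] C0C Cw maxC]] := maximal_cone _ _ cC0 C0w.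
have Cpos t : 0 < t -> C (0, t) by move=> t0; exact/C0C/C0pos.
have pairZ t x r : t *: ((x, r) : V * R) = (t *: x, t * r) by [].
have pairD x y r s : (x, r) + (y, s) = ((x + y, r + s) : V * R) by [].
have Clt t : C (0, t) -> 0 <= t.
  move=> Ct; rewrite leNgt; apply/negP => t0; apply: Cw.
  have := scaleC (- t^-1) _ _ Ct; rewrite oppr_gt0 invr_lt0 => /(_ t0).
  by rewrite pairZ scaler0 mulNr mulVf ?lt_eqF.
(* Adjoining the ray of [v] to [C] gives a cone. Either it avoids [(0, -1)], and then maximality
   puts it inside [C], or it contains [(0, -1)], necessarily with a positive multiple of [v]. *)
have ext v : (forall u, C u -> C (u + v)) \/
    exists c a, [/\ C c, 0 < a & c + a *: v = (0, -1)].
  pose D := [set u | exists c a, [/\ C c, 0 <= a & u = c + a *: v]].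
  have [Dw|nDw] := pselect (D (0, -1)).
    right; move: Dw => [c [a [Cc a0 e]]]; exists c, a; split=> //.
    rewrite lt_neqAle a0 andbT; apply/eqP => a00; apply: Cw.
    by rewrite e -a00 scale0r addr0.
  left=> u Cu; apply: (maxC D) => //; last 1 first.
  - by exists u, 1; split=> //; rewrite scale1r.
  - split=> [_ _ [c [a [Cc a0 ->]]] [c' [a' [Cc' a'0 ->]]]|t _ t0 [c [a [Cc a0 ->]]]].
      exists (c + c'), (a + a'); split; [exact: addC|exact: addr_ge0|].
      by rewrite scalerDl addrACA.
    exists (t *: c), (t * a); split; [exact: scaleC|by rewrite mulr_ge0// ltW|].
    by rewrite scalerDr scalerA.
  - by move=> c Cc; exists c, 0; split=> //; rewrite scale0r addr0.
(* Up to a small vertical shift, [C] contains each point or its opposite. Otherwise the two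
   witnesses from [ext] combine so that the multiples of [(x, r)] cancel, leaving a positive
   multiple of [(0, -1)] in [C]. This makes the sublinear [m] below odd, hence linear. *)
have dich x r e : 0 < e -> C (x, r + e) \/ C (- x, - r + e).
  move=> e0.
  have [h|[c [a [Cc a0 ec]]]] := ext (x, r).
    by left; have := h _ (Cpos _ e0); rewrite pairD add0r addrC.
  have [h|[c' [a' [Cc' a'0 ec']]]] := ext (- x, - r).
    by right; have := h _ (Cpos _ e0); rewrite pairD add0r addrC.
  exfalso; have aa0 : 0 < a + a' by exact: addr_gt0.
  have : C (a' *: c + a *: c') by apply: addC; apply: scaleC.
  have -> : a' *: c + a *: c' = (a + a') *: (0, -1).
    have -> : c = (0, -1) - a *: (x, r) by rewrite -ec addrK.
    have -> : c' = (0, -1) + a' *: (x, r).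
      by rewrite -ec' (_ : (- x, - r) = - (x, r))// scalerN subrK.
    rewrite scalerBr scalerDr !scalerA (mulrC a' a) addrACA addNr addr0.
    by rewrite -scalerDl (addrC a').
  move=> /(scaleC (a + a')^-1); rewrite invr_gt0 scalerA mulVf ?gt_eqF//.
  by rewrite scale1r => /(_ aa0).
pose E x := [set r | C (x, r)].
have Eup x r s : C (x, r) -> r < s -> C (x, s).
  move=> Cr rs; have := addC _ _ Cr (Cpos (s - r) _); rewrite subr_gt0 => /(_ rs).
  by rewrite pairD addr0 addrC subrK.
have E0 x : E x !=set0 by have [r /C0C] := C0tot x; exists r.
have Elb x : has_lbound (E x).
  have [s Es] := E0 (- x); exists (- s) => r Er.
  have := addC _ _ Er Es; rewrite pairD subrr => /Clt h.
  by rewrite -subr_ge0 opprK.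
have Einf x : has_inf (E x) by split.
pose m x := inf (E x).
have mE x r : C (x, r) -> m x <= r by move=> Cr; apply: ge_inf.
have mlt x r : m x < r -> C (x, r).
  rewrite -subr_gt0 => h; have [s Cs] := inf_adherent h (Einf x).
  by rewrite addrC subrK => /Eup; apply.
have mD x y : m (x + y) <= m x + m y.
  apply/ler_addgt0Pr => e e0; rewrite [e]splitr addrACA.
  have e20 : 0 < e / 2 by rewrite divr_gt0.
  have /mlt Cx : m x < m x + e / 2 by rewrite ltrDl.
  have /mlt Cy : m y < m y + e / 2 by rewrite ltrDl.
  by have := mE _ _ (addC _ _ Cx Cy).
have mN x : m (- x) = - m x.
  apply/eqP; rewrite eq_le; apply/andP; split; last first.
    rewrite -subr_ge0 opprK addrC; apply: le_trans (mD x (- x)).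
    by rewrite subrr; apply: lb_le_inf => // r; exact: Clt.
  rewrite lerNr; apply/ler_addgt0Pr => e e0.
  rewrite leNgt; apply/negP => h.
  have d0 : 0 < (m x - (- m (- x) + e)) by rewrite subr_gt0.
  (* Being smaller than both [e] and the gap in [h], this [d] contradicts each alternative of
     [dich]. *)
  pose d := Num.min e (m x - (- m (- x) + e)) / 2.
  have dmin : 0 < Num.min e (m x - (- m (- x) + e)) by rewrite lt_min e0.
  have d0' : 0 < d by rewrite divr_gt0.
  have de : d < e.
    by apply: (@lt_le_trans _ _ (Num.min e (m x - (- m (- x) + e))));
      [rewrite /d; lra|rewrite ge_min lexx].
  have de' : d < m x - (- m (- x) + e).
    by apply: (@lt_le_trans _ _ (Num.min e (m x - (- m (- x) + e))));
      [rewrite /d; lra|rewrite ge_min lexx orbT].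
  have [/mE|/mE] := dich x (- m (- x) + e) d d0'; lra.
have mDE x y : m (x + y) = m x + m y.
  apply/eqP; rewrite eq_le mD/=.
  by have := mD (- x) (- y); rewrite -opprD !mN -opprD lerN2.
have mZ t x : 0 < t -> m (t *: x) <= t * m x.
  move=> t0; apply/ler_addgt0Pr => e e0.
  have : m x < m x + t^-1 * e by rewrite ltrDl mulr_gt0// invr_gt0.
  move=> /mlt/(scaleC _ _ t0); rewrite pairZ => /mE; rewrite mulrDr mulrA mulfV ?mul1r//.
  by rewrite gt_eqF.
have mZpos t x : 0 < t -> m (t *: x) = t * m x.
  move=> t0; apply/eqP; rewrite eq_le mZ//=.
  have := mZ t (- x) t0; rewrite scalerN !mN; lra.
have m0 : m 0 = 0 by have := mN 0; rewrite oppr0; lra.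
have mlin : scalar m.
  move=> t x y; rewrite mDE; congr (_ + _).
  have [t0|t0|->] := ltrgtP t 0; last by rewrite scale0r mul0r m0.
    by rewrite -[t]opprK scaleNr mN mZpos ?oppr_gt0//; ring.
  exact: mZpos.
pose M := GRing.isLinear.Build _ _ _ _ m mlin.
pose L : {scalar V} := HB.pack m M.
by exists L => x r /C0C/mE.
Qed.

End hahn_banach.

(** * Iterates of linear operators, positivity and Birkhoff sums *)

Section linear_iterates.
Context {R : realType} {V : lmodType R}.

(** The iterates are bundled as linear maps so that the general lemmas on linearity apply to them,
    which a bare [iter n L] does not allow. *)
Fixpoint linpow (L : {linear V -> V}) n : {linear V -> V} :=
  if n is n'.+1 then L \o linpow L n' else idfun.

Lemma linpowE L n f : linpow L n f = iter n L f.
Proof. by elim: n => //= n ->. Qed.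

Lemma linpowD L m n f : linpow L (m + n) f = linpow L m (linpow L n f).
Proof. by rewrite !linpowE iterD. Qed.

Lemma linpow_comm (L : {linear V -> V}) n f : L (linpow L n f) = linpow L n (L f).
Proof. by rewrite !linpowE -iterS iterSr. Qed.

End linear_iterates.

Section continuous_functions.
Context {X : topologicalType} {R : realType}.
Notation T := (Cfun X R).
Implicit Types (f g phi psi : T) (L : {linear T -> T}).

Definition cexp f : T := expR \o f.

Lemma cexpD f g : cexp (f + g) = cexp f * cexp g.
Proof. by apply/continuousEP => x; rewrite /cexp/= expRD. Qed.

Lemma cfun_bounded f : compact [set: X] -> exists2 B, 0 <= B & forall x, `|f x| <= B.
Proof.
move=> cX; have /compact_bounded[M [Mr hM]] : compact (f @` [set: X]).
  by apply: continuous_compact => //; apply: continuous_subspaceT; exact: cts_fun.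
exists (`|M| + 1) => [|x]; first by rewrite addr_ge0.
by apply: hM; [rewrite (le_lt_trans (ler_norm _))// ltrDl|exists x].
Qed.

Lemma cfunBE f g x : (f - g) x = f x - g x. Proof. by []. Qed.

Definition positive L := forall f, cnonneg f -> cnonneg (L f).

Lemma positive_le L f g : positive L ->
  (forall x, f x <= g x) -> forall x, L f x <= L g x.
Proof.
move=> L0 fg x; rewrite -subr_ge0 (_ : _ - _ = L (g - f) x); last by rewrite linearB.
by apply: (L0 (g - f) _ x) => y; rewrite cfunBE subr_ge0.
Qed.

Lemma positive_linpow L n : positive L -> positive (linpow L n).
Proof. by move=> L0; elim: n => //= n IH f f0; apply/L0/IH. Qed.

Lemma state_le (m : {scalar T}) f g : states m ->
  (forall x, f x <= g x) -> m f <= m g.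
Proof.
move=> [m0 _] fg; rewrite -subr_ge0 -linearB.
by apply: (m0 (g - f)) => y; rewrite cfunBE subr_ge0.
Qed.

Lemma sum_cfunE (I : Type) (s : seq I) (P : pred I) (F : I -> T) x :
  (\sum_(i <- s | P i) F i) x = \sum_(i <- s | P i) F i x.
Proof.
by elim/big_rec2: _ => // i y1 y2 _ <-.
Qed.

Section birkhoff.
Variable alpha : continuousType X X.

Definition koopman f : T := f \o alpha.

Lemma koopman_linear : linear koopman.
Proof. by move=> a f g; apply/continuousEP. Qed.

HB.instance Definition _ := GRing.isLinear.Build R T T _ koopman koopman_linear.

Lemma koopman_positive : positive koopman.
Proof. by move=> f f0 x; apply: (f0 (alpha x)). Qed.

Lemma koopman_exp n f : linpow koopman n (cexp f) = cexp (linpow koopman n f).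
Proof. by elim: n => //= n ->; exact/continuousEP. Qed.

Lemma koopman1 n : linpow koopman n 1 = 1.
Proof. by elim: n => //= n ->; exact/continuousEP. Qed.

Definition birkhoff phi n : T := \sum_(i < n) linpow koopman i phi.

Lemma birkhoffS phi n : birkhoff phi n.+1 = birkhoff phi n + linpow koopman n phi.
Proof. by rewrite /birkhoff big_ord_recr. Qed.

Lemma birkhoffD phi psi n : birkhoff (phi + psi) n = birkhoff phi n + birkhoff psi n.
Proof. by rewrite /birkhoff -big_split; apply: eq_bigr => i _; rewrite linearD. Qed.

Lemma birkhoffZ c phi n : birkhoff (c *: phi) n = c *: birkhoff phi n.
Proof. by rewrite /birkhoff scaler_sumr; apply: eq_bigr => i _; rewrite linearZ. Qed.

Lemma birkhoff1 n x : birkhoff 1 n x = n%:R.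
Proof.
rewrite /birkhoff sum_cfunE; under eq_bigr do rewrite koopman1.
by rewrite sumr_const card_ord.
Qed.

Lemma birkhoff_coboundary f n :
  birkhoff (koopman f - f) n = linpow koopman n f - f.
Proof.
elim: n => [|n IH]; first by rewrite /birkhoff big_ord0 /= subrr.
by rewrite birkhoffS IH linearB -linpow_comm addrC addrA subrK.
Qed.

Lemma birkhoff_le phi psi n : (forall x, phi x <= psi x) ->
  forall x, birkhoff phi n x <= birkhoff psi n x.
Proof.
move=> le x; rewrite /birkhoff !sum_cfunE; apply: ler_sum => i _.
by apply: positive_le => //; apply/positive_linpow/koopman_positive.
Qed.

Lemma invariant_linpow (mu : {scalar T}) n f :
  invariant_states alpha mu -> mu (linpow koopman n f) = mu f.
Proof. by move=> [_ inv]; elim: n => //= n IH; rewrite [LHS]inv. Qed.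

Lemma invariant_birkhoff (mu : {scalar T}) phi n :
  invariant_states alpha mu -> mu (birkhoff phi n) = n%:R * mu phi.
Proof.
move=> inv; rewrite /birkhoff linear_sum/=.
under eq_bigr do rewrite invariant_linpow//.
by rewrite sumr_const card_ord mulr_natl.
Qed.

End birkhoff.
End continuous_functions.

(** * Jensen's inequality and the calculus of growth rates *)

(** The exponential lies above its tangent at the mean [c], and the tangent values average to
    [expR c]. *)
Lemma jensen_expR (R : realType) (I : Type) (s : seq I) (w u : I -> R) :
    (forall i, 0 <= w i) -> \sum_(i <- s) w i = 1 ->
  expR (\sum_(i <- s) w i * u i) <= \sum_(i <- s) w i * expR (u i).
Proof.
move=> w0 w1; set c := \sum_(i <- s) _.
rewrite [leLHS](_ : _ = \sum_(i <- s) w i * (expR c * (1 + (u i - c)))).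
  apply: ler_sum => i _; apply: ler_wpM2l => //.
  by rewrite -[u i in leRHS](subrKC c) expRD ler_wpM2l ?expR_ge0// expR_ge1Dx.
under eq_bigr do rewrite mulrCA.
rewrite -mulr_sumr; under eq_bigr do rewrite mulrDr mulr1 mulrBr.
by rewrite big_split/= sumrB w1 -mulr_suml w1 mul1r subrr addr0 mulr1.
Qed.

Section growth.
Context {X : topologicalType} {R : realType}.
Notation T := (Cfun X R).
Variables (alpha : continuousType X X) (J : nat -> {linear T -> T}).
Hypothesis J_pos : forall n, positive (J n).
Implicit Types (f g phi psi : T) (r : R).

(* [J n] is [A^n], or the identity in the construction of an invariant state. *)
Definition growth phi r := exists2 C, 0 < C &
  forall n x, J n (cexp (birkhoff alpha phi n)) x <= C * expR (n%:R * r).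

(** The common source of monotonicity, translation and coboundary invariance: by positivity, the
    bounded error [D] only enlarges the constant, while the linear error [n%:R * c] moves the
    rate. *)
Lemma growth_birkhoff phi psi r D c :
    (forall n x, birkhoff alpha psi n x <= birkhoff alpha phi n x + D + n%:R * c) ->
  growth phi r -> growth psi (r + c).
Proof.
move=> le [C C0 hC]; exists (expR D * C); first by rewrite mulr_gt0// expR_gt0.
move=> n x.
apply: (@le_trans _ _ (J n (expR (D + n%:R * c) *: cexp (birkhoff alpha phi n)) x)).
  apply: positive_le => // y.
  by rewrite cfunZE /cexp/= -expRD ler_expR addrC addrA; exact: le.
rewrite linearZ cfunZE.
rewrite [leRHS](_ : _ = expR (D + n%:R * c) * (C * expR (n%:R * r))).
  by rewrite ler_wpM2l ?expR_ge0//; exact: hC.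
by rewrite mulrDr !expRD; ring.
Qed.

Lemma growth_le phi psi r :
  (forall x, psi x <= phi x) -> growth phi r -> growth psi r.
Proof.
move=> le; rewrite -[r in growth psi r]addr0; apply: (@growth_birkhoff _ _ _ 0) => n x.
by rewrite mulr0 !addr0; exact: birkhoff_le.
Qed.

Lemma growth_ler phi r s : r <= s -> growth phi r -> growth phi s.
Proof.
move=> rs; rewrite -(subrKC r s); apply: (@growth_birkhoff _ _ _ 0) => n x.
by rewrite addr0 lerDl mulr_ge0// subr_ge0.
Qed.

Lemma growth_cst phi r c : growth phi r -> growth (phi + c *: (1 : T)) (r + c).
Proof.
apply: (@growth_birkhoff _ _ _ 0) => n x.
by rewrite birkhoffD birkhoffZ addr0 cfunDE cfunZE birkhoff1 mulrC.
Qed.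

(** The Birkhoff sums of a coboundary telescope, hence stay bounded uniformly in [n]. *)
Lemma growth_coboundary phi f r : compact [set: X] ->
  growth phi r -> growth (phi + (koopman alpha f - f)) r.
Proof.
move=> cX; have [B B0 fB] := cfun_bounded f cX.
rewrite -[r in X in _ -> X]addr0.
apply: (@growth_birkhoff _ _ _ (B + B)) => n x.
rewrite birkhoffD birkhoff_coboundary mulr0 addr0 cfunDE lerD2l lerD//.
  elim: n x => [|n IH] x; first exact: le_trans (ler_norm _) (fB x).
  exact: IH.
by rewrite (le_trans (ler_norm _))// [_ x](_ : _ = - f x)// normrN fB.
Qed.

(** Each exponential is first normalized by its own rate, through [u] and [v]. Pointwise convexity
    of the exponential then bounds the mixed term by an average, whose image under [J n] is at most
    [a * C + b * D]. *)
Lemma growth_convex phi psi r s (a b : R) : 0 < a -> 0 < b -> a + b = 1 ->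
  growth phi r -> growth psi s -> growth (a *: phi + b *: psi) (a * r + b * s).
Proof.
move=> a0 b0 ab1 [C C0 hC] [D D0 hD]; exists (a * C + b * D).
  by rewrite addr_gt0// mulr_gt0.
move=> n x; set F := birkhoff alpha phi n; set G := birkhoff alpha psi n.
set e := expR (n%:R * (a * r + b * s)).
set u := expR (- (n%:R * r)); set v := expR (- (n%:R * s)).
apply: (@le_trans _ _ (J n (e *: ((a * u) *: cexp F + (b * v) *: cexp G)) x)).
  apply: positive_le => // y.
  rewrite birkhoffD !birkhoffZ -/F -/G cfunZE cfunDE !cfunZE /cexp/= cfunDE !cfunZE.
  have := @jensen_expR R bool [:: true; false] (fun i => if i then a else b)
    (fun i => if i then F y - n%:R * r else G y - n%:R * s).
  rewrite !big_cons !big_nil !addr0 => /(_ _ ab1) h.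
  rewrite [expR (F y - _)]expRD [expR (G y - _)]expRD -/u -/v in h.
  rewrite -ler_pdivrMl ?expR_gt0// -expRN -expRD.
  rewrite -!mulrA (mulrC u) (mulrC v); apply: le_trans (h _); last by case; exact: ltW.
  by rewrite ler_expR; lra.
rewrite linearZ linearD !linearZ !cfunZE cfunDE !cfunZE mulrC ler_wpM2r ?expR_ge0//.
have hu : u * J n (cexp F) x <= C.
  by rewrite /u expRN mulrC ler_pdivrMr ?expR_gt0.
have hv : v * J n (cexp G) x <= D.
  by rewrite /v expRN mulrC ler_pdivrMr ?expR_gt0.
by rewrite -!mulrA lerD// ler_wpM2l// ltW.
Qed.

End growth.

(** * Subgradients of the growth rate are invariant states *)

Section subgradient.
Context {X : topologicalType} {R : realType}.
Notation T := (Cfun X R).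
Variables (alpha : continuousType X X) (J : nat -> {linear T -> T}).
Hypotheses (X_compact : compact [set: X]) (J_pos : forall n, positive (J n)).
Notation growth := (growth alpha J).

Lemma growth_exists r0 : growth 0 r0 -> forall phi, exists r, growth phi r.
Proof.
move=> g0 phi; have [B B0 hB] := cfun_bounded phi X_compact.
exists (r0 + B); apply: growth_le (growth_cst _ _ J_pos _ _ B g0) => // x.
by rewrite cfunDE cfunZE/= add0r mulr1 (le_trans (ler_norm _)).
Qed.

Lemma growth_subgradient r0 phi l : growth 0 r0 ->
    (forall r, growth phi r -> l <= r) ->
  exists mu : {scalar T}, exists L, [/\ invariant_states alpha mu,
    forall r, growth phi r -> L <= r,
    forall e, 0 < e -> growth phi (L + e) &
    forall psi r, growth psi r -> mu psi - mu phi <= r - L].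
Proof.
move=> g0 lP; pose E := [set r | growth phi r].
have E0 : E !=set0 by have [r] := growth_exists _ g0 phi; exists r.
have Elb : has_lbound E by exists l.
pose L := inf E.
have LE r : growth phi r -> L <= r by move=> gr; exact: ge_inf.
have Lgrowth e : 0 < e -> growth phi (L + e).
  move=> e0; have [//|r gr /ltW rL] := @inf_adherent _ E _ e0.
  exact: growth_ler gr.
(* This is the cone generated by the epigraph of the growth rate after [(phi, L)] has been moved to
   the origin. A linear functional dominated on it is a subgradient at [phi]. *)
pose C0 : set (T * R) := [set v | exists2 t, 0 < t &
  exists2 r, growth (phi + t *: v.1) r & r <= L + t * v.2].
have [|||x|mu muP] := @dominated_extension _ _ C0.
- split=> [[h s] [h' s']|t [h s] t0]; last first.
    move=> [a a0 [r gr rL]]; exists (a / t); first by rewrite divr_gt0.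
    exists r; first by rewrite /= scalerA -mulrA mulVf ?mulr1// gt_eqF.
    by rewrite /= [_ *: _](_ : _ = t * s)// mulrA -(mulrA a) mulVf ?mulr1// gt_eqF.
  move=> [t t0 [r gr rL]] [t' t'0 [r' gr' rL']] /=; rewrite /= in gr gr' rL rL'.
  have tt0 : 0 < t + t' by rewrite addr_gt0.
  have tt : t + t' != 0 by rewrite gt_eqF.
  pose a := t' / (t + t'); pose b := t / (t + t').
  have a0 : 0 < a by rewrite divr_gt0.
  have b0 : 0 < b by rewrite divr_gt0.
  have ab : a + b = 1 by rewrite -mulrDl addrC divff.
  (* The weights [a] and [b] make [a * t = b * t'], so the convex combination of the two
     perturbations of [phi] is a perturbation along the sum of the directions at this common
     scale. *)
  exists (t * t' / (t + t')); first by rewrite divr_gt0// mulr_gt0.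
  have at_ : a * t = t * t' / (t + t') by rewrite /a; ring.
  have bt : b * t' = t * t' / (t + t') by rewrite /b; ring.
  exists (a * r + b * r').
    have := growth_convex _ _ J_pos _ _ _ _ _ _ a0 b0 ab gr gr'.
    rewrite !scalerDr addrACA -scalerDl ab scale1r !scalerA at_ bt.
    by rewrite -scalerDr.
  rewrite mulrDr -[X in X * s]at_ -bt.
  have -> : L = a * L + b * L by rewrite -mulrDl ab mul1r.
  by rewrite addrACA -(mulrA a) -(mulrA b) -!mulrDr lerD// ler_wpM2l// ltW.
- move=> [t t0 [r]]; rewrite /= scaler0 addr0 => /LE; lra.
- move=> t t0; exists 1 => //; exists (L + t); rewrite /= ?scaler0 ?addr0 ?mul1r//.
  exact: Lgrowth.
- have [r gr] := growth_exists _ g0 (phi + x).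
  by exists (r - L), 1 => //; exists r; rewrite /= ?scale1r// mul1r addrC subrK.
have muG psi r : growth psi r -> mu psi - mu phi <= r - L.
  move=> gr; rewrite -linearB; apply: muP; exists 1 => //; exists r => /=.
    by rewrite scale1r addrC subrK.
  by rewrite mul1r addrC subrK.
(* A bound on the change of the rate along [h] bounds [mu h]. The directions [- f] with [f]
   nonnegative, [1] and [- 1], and the coboundaries give positivity, normalization and
   invariance. *)
have muGe h c : (forall e, 0 < e -> growth (phi + h) (L + e + c)) -> mu h <= c.
  move=> H; apply/ler_addgt0Pr => e e0.
  have := muG _ _ (H e e0); rewrite linearD; lra.
exists mu, L; split=> //; split; first split.
- move=> f f0; rewrite -oppr_le0 -linearN; apply: muGe => e e0; rewrite addr0.
  apply: growth_le (Lgrowth e e0) => // x.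
  by rewrite [leLHS](_ : _ = phi x - f x)// lerBlDr lerDl; exact: f0.
- apply/eqP; rewrite eq_le; apply/andP; split.
    by apply: muGe => e e0; rewrite -[X in phi + X]scale1r; exact/growth_cst/Lgrowth.
  rewrite -lerN2 -linearN; apply: muGe => e e0.
  by rewrite -scaleN1r; exact/growth_cst/Lgrowth.
- move=> f; rewrite -/(koopman alpha f).
  have hf g : mu (koopman alpha g - g) <= 0.
    by apply: muGe => e e0; rewrite addr0; apply: growth_coboundary => //; exact: Lgrowth.
  apply/eqP; rewrite eq_le -subr_le0 -linearB hf/= -subr_le0.
  have := hf (- f); rewrite linearN -opprB linearN /= !linearB /= linearN; lra.
Qed.

End subgradient.

(** * The spectral potential as the infimum of the growth rates *)

Lemma lee_forall_ge (R : realType) (x y : \bar R) :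
  (forall r : R, (y <= r%:E)%E -> (x <= r%:E)%E) -> (x <= y)%E.
Proof.
case: y => [y||] h; [exact: h|exact: leey|].
by rewrite (eq_ninfty (fun r => h r (leNye _))).
Qed.

(** An abstract form of Fekete's lemma: the first hypothesis puts the infimum of [S] below every
    term of positive index, and the second puts the upper limit below that infimum. *)
Lemma cvg_ereal_inf (R : realType) (u : nat -> \bar R) (S : set R) :
    (forall n r, (0 < n)%N -> (u n <= r%:E)%E -> S r) ->
    (forall r e, S r -> 0 < e -> \forall n \near \oo, (u n <= (r + e)%:E)%E) ->
  u n @[n --> \oo] --> ereal_inf (EFin @` S).
Proof.
(* The shift discards index 0, since [lo] speaks of positive indices. *)
move=> lo hi; rewrite -cvg_shiftS; apply: limn_esup_le_cvg; last first.
  move=> n; apply: lee_forall_ge => r /lo Sr.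
  by apply: ereal_inf_lbound; exists r => //; exact: Sr.
apply: le_ereal_inf_tmp => _ [r Sr <-]; apply/lee_addgt0Pr => e e0.
have [N _ hN] := hi _ _ Sr e0.
apply: ge_ereal_inf; exists (ereal_sup [set u n.+1 | n in [set n | (N <= n)%N]]).
  by exists [set n | (N <= n)%N] => //; exists N.
by apply: ge_ereal_sup => _ [n /= Nn <-]; apply: hN; apply: leqW.
Qed.

Section spectral_potential.
Context {X : topologicalType} {R : realType}.
Notation T := (Cfun X R).
Variables (alpha : continuousType X X) (A : {linear T -> T}).
Hypotheses (x0 : X) (X_compact : compact [set: X]).
Hypothesis A_transfer : transfer_operator alpha A.
Implicit Types (f g phi psi : T).

Lemma transfer_positive : positive A. Proof. exact: A_transfer.1. Qed.

Lemma transfer_linpow n f g :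
  linpow A n (linpow (koopman alpha) n f * g) = f * linpow A n g.
Proof.
elim: n f g => //= n IH f g.
rewrite linpow_comm.
rewrite -[A (_ * g)]/(A ((linpow (koopman alpha) n f \o alpha : T) * g)).
by rewrite A_transfer.2 IH linpow_comm.
Qed.

(** The homological identity carries the outer factor [cexp phi] inside [linpow A n], where it
    becomes the next summand of the Birkhoff sum. *)
Lemma iter_weighted phi n f :
  iter n (weighted A phi) f = linpow A n (cexp (birkhoff alpha phi n) * f).
Proof.
elim: n f => [|n IH] f.
  rewrite /= /birkhoff big_ord0 (_ : cexp 0 = 1) ?mul1r//.
  by apply/continuousEP => x; rewrite /cexp/= expR0.
rewrite iterS IH /weighted -/(cexp phi) -transfer_linpow koopman_exp.
by rewrite birkhoffS cexpD mulrCA mulrA.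
Qed.

Lemma weighted_pow phi n :
  linpow A n (cexp (birkhoff alpha phi n)) = iter n (weighted A phi) 1.
Proof. by rewrite iter_weighted mulr1. Qed.

Lemma iter_weighted_le phi n f g : (forall x, f x <= g x) ->
  forall x, iter n (weighted A phi) f x <= iter n (weighted A phi) g x.
Proof.
move=> fg; rewrite !iter_weighted; apply: positive_le.
  exact/positive_linpow/transfer_positive.
by move=> x; rewrite !cfunME ler_wpM2l ?expR_ge0.
Qed.

Lemma iter_weightedZ phi n c f :
  iter n (weighted A phi) (c *: f) = c *: iter n (weighted A phi) f.
Proof.
rewrite !iter_weighted -linearZ; congr (linpow A n _).
by apply/continuousEP => x; exact: mulrCA.
Qed.

Lemma iter_weighted_ge0 phi n x : 0 <= iter n (weighted A phi) 1 x.
Proof.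
rewrite -weighted_pow; apply: (positive_linpow _ _ transfer_positive) => y.
exact: expR_ge0.
Qed.

(** Submultiplicativity: a bound on one power controls all powers, since blocks of length [n] can be
    split off until fewer than [n] steps remain. *)
Lemma growth_of_power phi n r : (0 < n)%N ->
    (forall x, iter n (weighted A phi) 1 x <= expR (n%:R * r)) ->
  growth alpha (linpow A) phi r.
Proof.
move=> n0 hn; pose w k := iter k (weighted A phi) 1 : T.
have wb k : exists B, 0 <= B /\ forall x, w k x <= B.
  have [B B0 hB] := cfun_bounded (w k) X_compact.
  by exists B; split=> // x; exact: le_trans (ler_norm _) (hB x).
have [B hB] := choice wb.
(* The sum dominates the normalized bounds of all powers below [n], and the summand 1 makes [C]
   positive. *)
pose C := 1 + \sum_(k < n) B k * expR (- (k%:R * r)).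
have C0 : 0 < C.
  rewrite ltr_pwDl// sumr_ge0// => k _; rewrite mulr_ge0 ?expR_ge0//.
  exact: (hB _).1.
exists C => // k x; rewrite weighted_pow -/(w k).
elim/ltn_ind: k x => k IH x; have [kn|nk] := ltnP k n.
  apply: le_trans ((hB k).2 x) _.
  rewrite -ler_pdivrMr ?expR_gt0// -expRN /C (bigD1 (Ordinal kn))//=.
  rewrite addrCA lerDl addr_ge0// sumr_ge0// => i _.
  by rewrite mulr_ge0 ?expR_ge0//; exact: (hB _).1.
have kE : w k = iter (k - n) (weighted A phi) (w n) by rewrite /w -iterD subnK.
rewrite kE.
apply: (@le_trans _ _ (iter (k - n) (weighted A phi) (expR (n%:R * r) *: (1 : T)) x)).
  by apply: iter_weighted_le => y; rewrite cfunZE/= mulr1; exact: hn.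
rewrite iter_weightedZ cfunZE.
have h := IH (k - n)%N _ x.
apply: (@le_trans _ _ (expR (n%:R * r) * (C * expR ((k - n)%:R * r)))).
  by rewrite ler_wpM2l ?expR_ge0//; apply: h; rewrite ltn_subrL n0 (leq_trans n0).
by rewrite mulrCA -expRD -mulrDl -natrD subnKC.
Qed.

Lemma opnorm_weighted_ge phi n x :
  ((iter n (weighted A phi) 1 x)%:E <= opnorm (iter n (weighted A phi)))%E.
Proof.
apply: (@le_trans _ _ (unorm (iter n (weighted A phi) 1))).
  apply: (@le_trans _ _ (`|iter n (weighted A phi) 1 x|%:E)).
    by rewrite lee_fin ler_norm.
  by apply: ereal_sup_ubound; exists x.
apply: ereal_sup_ubound; exists 1 => //=.
by apply: ge_ereal_sup => _ [y _ <-]; rewrite lee_fin /= normr1.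
Qed.

(** A function in the unit ball lies between [-1] and [1], so positivity squeezes its image between
    the images of these constants. *)
Lemma opnorm_weighted_le phi n c :
    (forall x, iter n (weighted A phi) 1 x <= c) ->
  (opnorm (iter n (weighted A phi)) <= c%:E)%E.
Proof.
move=> h; apply: ge_ereal_sup => _ [f /= f1 <-].
have {}f1 x : `|f x| <= 1.
  by rewrite -lee_fin; apply: le_trans f1; apply: ereal_sup_ubound; exists x.
apply: ge_ereal_sup => _ [x _ <-]; rewrite lee_fin ler_norml; apply/andP; split.
  apply: (@le_trans _ _ (iter n (weighted A phi) ((-1) *: (1 : T)) x)).
    by rewrite iter_weightedZ cfunZE mulN1r lerN2.
  apply: iter_weighted_le => y; rewrite cfunZE/= mulr1.
  by have := f1 y; rewrite ler_norml => /andP[].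
apply: le_trans (h x); apply: iter_weighted_le => y.
exact: le_trans (ler_norm _) (f1 y).
Qed.

Lemma spectral_potentialE phi :
  spectral_potential A phi = ereal_inf (EFin @` growth alpha (linpow A) phi).
Proof.
apply/cvg_lim => //; apply: cvg_ereal_inf => [n r n0|r e [C C0 hC] e0].
  rewrite lee_pdivrMl ?ltr0n// -EFinM => h.
  apply: (@growth_of_power _ n) => // x; rewrite -lee_fin.
  apply: le_trans (opnorm_weighted_ge _ _ _) _.
  (* The exponential inverts [lne] on nonnegative arguments only; evaluation at [x0] shows that the
     norm is one. *)
  rewrite -[leLHS]lneK; last first.
    rewrite in_itv/= leey andbT; apply: le_trans (opnorm_weighted_ge phi n x0).
    by rewrite lee_fin iter_weighted_ge0.
  by rewrite -[leRHS]/(expeR (n%:R * r)%:E) lee_expeR.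
near=> n.
have n0 : (0 < n)%N by near: n; exists 1%N.
rewrite lee_pdivrMl ?ltr0n//.
have CE : 0 < C * expR (n%:R * r) by rewrite mulr_gt0 ?expR_gt0.
apply: (@le_trans _ _ (lne (C * expR (n%:R * r))%:E)).
  rewrite lee_lne ?in_itv/= ?leey ?andbT ?lee_fin ?(ltW CE)//.
    by apply: opnorm_weighted_le => x; rewrite -weighted_pow.
  apply: le_trans (opnorm_weighted_ge phi n x0).
  by rewrite lee_fin iter_weighted_ge0.
rewrite lne_EFin// lnM ?posrE ?expR_gt0// expRK -EFinM lee_fin mulrDr addrC lerD2l.
rewrite -ler_pdivrMr//; near: n; exact: nbhs_infty_ger.
Unshelve. all: by end_near.
Qed.

End spectral_potential.

(** * Partitions of unity subordinate to the level bands of a function *)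

(* A partition of unity is a set, so a repeated member of a decomposition of 1 has to be
   absorbed into its double, which may coincide with another member in turn. *)
Section merging.
Variables (V : nmodType) (P : V -> Prop).
Hypothesis P_double : forall g, P g -> P (g + g).

(** Each collision removes a member of the list before [g + g] is inserted, so induction on the
    length terminates. *)
Lemma insert_merging (s : seq V) g : uniq s -> (forall h, h \in s -> P h) -> P g ->
  exists s', [/\ uniq s', forall h, h \in s' -> P h &
    \sum_(h <- s') h = g + \sum_(h <- s) h].
Proof.
have [n] := ubnP (size s); elim: n s g => // n IH s g sn us sP gP.
have [gs|gs] := boolP (g \in s); last first.
  exists (g :: s); split; rewrite ?big_cons//=; first by rewrite gs.
  by move=> h; rewrite inE => /predU1P[->//|]; exact: sP.
have [||s' [us' s'P s'E]] := IH (rem g s) (g + g) _ (rem_uniq _ us) _ (P_double _ gP).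
- by rewrite size_rem// prednK//; case: (s) gs.
- by move=> h /mem_rem; exact: sP.
exists s'; split=> //; rewrite s'E -addrA; congr (_ + _).
by rewrite (perm_big _ (perm_to_rem gs)) big_cons.
Qed.

Lemma merge_duplicates (s : seq V) : (forall h, h \in s -> P h) ->
  exists s', [/\ uniq s', forall h, h \in s' -> P h &
    \sum_(h <- s') h = \sum_(h <- s) h].
Proof.
elim: s => [|g s IH] sP; first by exists [::].
have [|s1 [us1 s1P s1E]] := IH; first by move=> h hs; apply: sP; rewrite inE hs orbT.
have [|s' [us' s'P s'E]] := insert_merging s1 g us1 s1P.
  by apply: sP; rewrite mem_head.
by exists s'; split=> //; rewrite s'E s1E big_cons.
Qed.

End merging.

Section partitions.
Context {X : topologicalType} {R : realType}.
Notation T := (Cfun X R).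
Implicit Types (f g psi : T).

Lemma cnorm_continuous f : continuous (fun x => `|f x|).
Proof. by move=> x; apply: cvg_norm; exact: cts_fun. Qed.

Definition cnorm f : T := mkcts (cnorm_continuous f).

(* This is min(max(f, 0), 1). *)
Definition clamp f : T := 2^-1 *: (cnorm f - cnorm (f - 1) + 1).

Lemma clampE f x : clamp f x = (`|f x| - `|f x - 1| + 1) / 2.
Proof. by rewrite /clamp cfunZE mulrC. Qed.

Lemma clamp_ge1 f x : 1 <= f x -> clamp f x = 1.
Proof. by rewrite clampE; case: (ger0P (f x)); case: (ger0P (f x - 1)); lra. Qed.

Lemma clamp_le0 f x : f x <= 0 -> clamp f x = 0.
Proof. by rewrite clampE; case: (ger0P (f x)); case: (ger0P (f x - 1)); lra. Qed.

(** The difference of [c k] and [c k.+1] is a tent function of [psi], centred at [k%:R - B] and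
    vanishing at distance 1 or more from there. The tents telescope from [c 0 = 1] to [c M = 0].
    Doubling a tent keeps its support, so duplicates can be merged. *)
Lemma fine_partition psi : compact [set: X] -> exists s : seq T,
  [/\ uniq s, forall g, g \in s -> cnonneg g, \sum_(g <- s) g = 1 &
    forall g, g \in s -> exists c, forall x, g x != 0 -> `|psi x - c| <= 1].
Proof.
move=> cX; have [B B0 hB] := cfun_bounded psi cX.
pose c k : T := clamp (psi + (B + 1 - k%:R) *: (1 : T)).
have cE k x : (psi + (B + 1 - k%:R) *: (1 : T)) x = psi x + B + 1 - k%:R.
  by rewrite cfunDE cfunZE/= mulr1 !addrA.
have psiB x : - B <= psi x <= B by rewrite -ler_norml.
have [M _ hM] := nbhs_infty_ger (2 * B + 1).
pose P g := cnonneg g /\ exists c, forall x, g x != 0 -> `|psi x - c| <= 1.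
have [g|h|s [us sP sE]] := @merge_duplicates _ P _ [seq c k - c k.+1 | k <- iota 0 M].
- move=> [g0 [a ha]]; split; first by move=> x; rewrite cfunDE addr_ge0.
  exists a => x gg; apply: ha; apply: contra_neq gg.
  by rewrite cfunDE => ->; rewrite addr0.
- move=> /mapP[k _ ->].
  have hE x : (c k - c k.+1) x =
      (`|psi x + B + 1 - k%:R| - `|psi x + B - k%:R| * 2 + `|psi x + B - 1 - k%:R|) / 2.
    rewrite cfunBE /c !clampE !cE -(natr1 k).
    have -> : psi x + B + 1 - k%:R - 1 = psi x + B - k%:R by ring.
    have -> : psi x + B + 1 - (k%:R + 1) = psi x + B - k%:R by ring.
    have -> : psi x + B - k%:R - 1 = psi x + B - 1 - k%:R by ring.
    by field.
  split=> [x|].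
    rewrite hE; case: (ger0P (psi x + B + 1 - k%:R));
    case: (ger0P (psi x + B - k%:R)); case: (ger0P (psi x + B - 1 - k%:R)); lra.
  exists (k%:R - B) => x; apply: contra_neqT; rewrite -ltNge hE.
  rewrite opprB addrA; case: (ger0P (psi x + B - k%:R));
  case: (ger0P (psi x + B + 1 - k%:R)); case: (ger0P (psi x + B - 1 - k%:R)); lra.
exists s; split=> //.
- by move=> g /sP[].
- rewrite sE big_map -{1}[M]subn0 -/(index_iota 0 M).
  rewrite -[LHS]opprK -sumrN; under eq_bigr do rewrite opprB.
  rewrite telescope_sumr// opprB; apply/continuousEP => x; rewrite cfunBE.
  have := psiB x; move/andP => [x1 x2].
  rewrite /c clamp_ge1 ?cE; last by lra.
  rewrite clamp_le0 ?subr0// cE; have := hM M (leqnn M); lra.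
- by move=> g /sP[].
Qed.

Lemma finite_set_uniq (D : set T) : finite_set D ->
  exists2 s : seq T, uniq s & D = [set` s].
Proof.
move=> /finite_seqP[s ->]; exists (undup s); first exact: undup_uniq.
by apply/seteqP; split=> g /=; rewrite mem_undup.
Qed.

Lemma partition_of_unity_seq (s : seq T) : uniq s ->
  partition_of_unity [set` s] <->
  ((forall g, g \in s -> cnonneg g) /\ \sum_(g <- s) g = 1).
Proof.
move=> us; rewrite /partition_of_unity /= -fsbig_seq//; split=> [[_]//|[s0 s1]].
by split=> //; exact: finite_seq.
Qed.

Lemma tau_nD_seq (A : {linear T -> T}) n (mu : {scalar T}) (s : seq T) : uniq s ->
  tau_nD A n mu [set` s] =
  ereal_sup [set (\sum_(g <- s) tau_term A n mu m g)%E | m in states].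
Proof.
by move=> us; congr ereal_sup; apply: eq_imagel => m _; rewrite -fsbig_seq.
Qed.

End partitions.

(** * The upper bound for the t-entropy *)

Section young.
Context {X : topologicalType} {R : realType}.
Notation T := (Cfun X R).
Variables (alpha : continuousType X X) (A : {linear T -> T}).
Hypotheses (X_compact : compact [set: X]).
Hypothesis A_transfer : transfer_operator alpha A.

(** The Fenchel-Young inequality for the logarithm: it is ln z <= z - 1 at z = m(A^n g) exp(c) /
    mu(g), multiplied by mu(g). It makes the summands linear in [m], with a free parameter [c]. *)
Lemma tau_term_le n (mu m : {scalar T}) g c :
    0 <= mu g -> 0 <= m (iter n A g) ->
  (tau_term A n mu m g <= (m (iter n A g) * expR c - mu g - mu g * c)%:E)%E.
Proof.
rewrite /tau_term => mu0 m0; have [->|mun0] := eqVneq (mu g) 0.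
  by rewrite mul0r !subr0 lee_fin mulr_ge0 ?expR_ge0.
have {mun0}mu0 : 0 < mu g by rewrite lt_neqAle eq_sym mun0.
have [->|mn0] := eqVneq (m (iter n A g)) 0.
  by rewrite mul0r le0_lneNy ?lexx// gt0_muleNy ?lte_fin// leNye.
have {mn0}m0 : 0 < m (iter n A g) by rewrite lt_neqAle eq_sym mn0.
set y := m _ in m0 *.
have yy : 0 < y / mu g * expR c by rewrite mulr_gt0 ?expR_gt0// divr_gt0.
rewrite lne_EFin ?divr_gt0// -EFinM lee_fin.
have /le_ln1Dx : -1 < y / mu g * expR c - 1 by lra.
rewrite subrKC lnM ?posrE ?expR_gt0 ?divr_gt0// expRK => h.
have := ler_wpM2l (ltW mu0) h; rewrite mulrDr mulrBr mulr1 mulrA.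
by rewrite [mu g * (y / mu g)]mulrCA divff ?gt_eqF// mulr1; lra.
Qed.

Lemma tau_n_le (mu : {scalar T}) phi C n : invariant_states alpha mu ->
    (forall x, linpow A n (cexp (birkhoff alpha phi n)) x <= expR C) ->
  (tau_n A n mu <= (C + 2 - n%:R * mu phi)%:E)%E.
Proof.
move=> inv hC; have [mu_st mu_inv] := inv; have [mu0 mu1] := mu_st.
have Apos := transfer_positive alpha A A_transfer.
set S := birkhoff alpha phi n.
have [s [us s0 s1 sosc]] := fine_partition S X_compact.
apply: ge_ereal_inf; exists (tau_nD A n mu [set` s]).
  by exists [set` s] => //; exact/partition_of_unity_seq.
rewrite tau_nD_seq//; apply: ge_ereal_sup => _ [m [m0 m1] <-].
have [c hc] : exists c : T -> R, forall g, g \in s ->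
    forall x, g x != 0 -> `|S x - c g| <= 1.
  have /choice[c hc] : forall g, exists a, g \in s ->
      forall x, g x != 0 -> `|S x - a| <= 1.
    move=> g; have [/sosc[a ha]|_] := boolP (g \in s); first by exists a.
    by exists 0.
  by exists c.
have cS g x : g \in s -> g x * (S x - 1) <= g x * c g /\
    g x * expR (c g) <= g x * expR (S x + 1).
  move=> gs; have gx0 := s0 _ gs x.
  have [->|/(hc _ gs)] := eqVneq (g x) 0; first by rewrite !mul0r.
  by rewrite ler_norml => h; split; rewrite ler_wpM2l// ?ler_expR; lra.
(* The parameter for [g] is [c g - L]. The added 1 pays for replacing [c g] by [S + 1] in the
   exponentials, so that [h1] holds; the other 1 in the final constant 2 is the error in [h2]. *)
pose L := C + 1.
have termle g : g \in s -> (tau_term A n mu m g <=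
    (m (iter n A g) * expR (c g - L) - mu g - mu g * (c g - L))%:E)%E.
  move=> gs; apply: tau_term_le; first exact/mu0/s0.
  by apply: m0; rewrite -linpowE; apply: positive_linpow => //; exact: s0.
rewrite big_seq; apply: le_trans; first by apply: lee_sum => g gs; exact: termle.
rewrite -big_seq sumEFin lee_fin !sumrB.
have summu : \sum_(g <- s) mu g = 1 by rewrite -linear_sum s1.
rewrite summu.
have h1 : \sum_(g <- s) m (iter n A g) * expR (c g - L) <= 1.
  under eq_bigr do rewrite expRD mulrA.
  rewrite -mulr_suml expRN ler_pdivrMr ?expR_gt0// mul1r.
  apply: (@le_trans _ _ (m (linpow A n (expR 1 *: cexp S)))).
    have -> : \sum_(g <- s) m (iter n A g) * expR (c g) =
        m (linpow A n (\sum_(g <- s) expR (c g) *: g)).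
      rewrite !linear_sum; apply: eq_bigr => g _.
      by rewrite !linearZ /= linpowE mulrC.
    apply: state_le => //; apply: positive_le; first exact: positive_linpow.
    move=> x; rewrite sum_cfunE.
    have -> : (expR 1 *: cexp S) x = \sum_(g <- s) g x * expR (S x + 1).
      by rewrite -mulr_suml -sum_cfunE s1 mul1r cfunZE /cexp/= expRD mulrC.
    rewrite big_seq [leRHS]big_seq; apply: ler_sum => g gs.
    by rewrite cfunZE mulrC; exact: (cS _ _ gs).2.
  rewrite !linearZ /= /L expRD mulrC ler_wpM2r ?expR_ge0//.
  apply: (@le_trans _ _ (m (expR C *: (1 : T)))).
    by apply: state_le => // x; rewrite cfunZE/= mulr1; exact: hC.
  by rewrite linearZ /= m1 mulr1.
have h2 : n%:R * mu phi - 1 <= \sum_(g <- s) mu g * c g.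
  rewrite -(invariant_birkhoff alpha)// -/S -[X in _ - X]mu1 -linearB.
  have -> : \sum_(g <- s) mu g * c g = mu (\sum_(g <- s) c g *: g).
    by rewrite linear_sum; apply: eq_bigr => g _; rewrite linearZ/= mulrC.
  apply: state_le => // x; rewrite sum_cfunE cfunBE.
  have -> : S x - (1 : T) x = \sum_(g <- s) g x * (S x - 1).
    by rewrite -mulr_suml -sum_cfunE s1 mul1r.
  rewrite big_seq [leRHS]big_seq; apply: ler_sum => g gs.
  by rewrite cfunZE [leRHS]mulrC; exact: (cS _ _ gs).1.
under [X in _ - X]eq_bigr do rewrite mulrBr.
by rewrite sumrB -mulr_suml summu mul1r /L; rewrite /L in h1; lra.
Qed.

Lemma t_entropy_le (mu : {scalar T}) phi r : invariant_states alpha mu ->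
  growth alpha (linpow A) phi r -> (t_entropy A mu <= (r - mu phi)%:E)%E.
Proof.
move=> inv [C C0 hC]; apply/lee_addgt0Pr => e e0.
(* For such [N] the additive error [ln C + 2] costs at most [e] after division by [N.+1]. *)
have [N _ hN] := nbhs_infty_ger ((ln C + 2) / e).
apply: ge_ereal_inf; exists ((N.+1%:R^-1)%:E * tau_n A N.+1 mu)%E.
  by exists N.+1.
rewrite lee_pdivrMl ?ltr0n// -EFinD -EFinM.
apply: (le_trans (tau_n_le mu phi (ln C + N.+1%:R * r) _ inv _)).
  by move=> x; rewrite expRD lnK ?posrE.
have := hN N.+1 (leqnSn N); rewrite ler_pdivrMr// lee_fin => h.
rewrite mulrDr mulrBr; lra.
Qed.

End young.

(** * Constructions of states and elementary estimates *)

Section states.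
Context {X : topologicalType} {R : realType}.
Notation T := (Cfun X R).

Lemma scalar_of_fun (f : T -> R) : scalar f -> exists m : {scalar T}, forall g, m g = f g.
Proof.
move=> f_lin; pose M := GRing.isLinear.Build _ _ _ _ f f_lin.
by pose L : {scalar T} := HB.pack f M; exists L.
Qed.

Lemma state_eval (x : X) : exists2 m : {scalar T}, states m & forall g, m g = g x.
Proof.
have [|m mE] := scalar_of_fun (fun g => g x); first by [].
by exists m => //; split=> [f f0|]; rewrite mE.
Qed.

Lemma state_convex (m m' : {scalar T}) (a b : R) : states m -> states m' ->
    0 <= a -> 0 <= b -> a + b = 1 ->
  exists2 m'' : {scalar T}, states m'' & forall g, m'' g = a * m g + b * m' g.
Proof.
move=> [m0 m1] [m'0 m'1] a0 b0 ab.
have [|m'' mE] := scalar_of_fun (fun g => a * m g + b * m' g).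
  by move=> k f g; rewrite !linearP /=; ring.
exists m'' => //; split=> [f f0|]; rewrite mE; last by rewrite m1 m'1 !mulr1.
by rewrite addr_ge0// mulr_ge0// ?m0 ?m'0.
Qed.

Lemma state_mixture (s : seq T) (w : T -> R) (p : T -> X) :
    (forall g, g \in s -> 0 <= w g) -> \sum_(g <- s) w g = 1 ->
  exists2 m : {scalar T}, states m & forall f, m f = \sum_(g <- s) w g * f (p g).
Proof.
move=> w0 w1; have [|m mE] := scalar_of_fun (fun f => \sum_(g <- s) w g * f (p g)).
  move=> k f g; rewrite mulr_sumr -big_split /=; apply: eq_bigr => h _.
  by rewrite cfunDE cfunZE; ring.
exists m => //; split=> [f f0|]; rewrite mE; last by under eq_bigr do rewrite mulr1.
by rewrite big_seq sumr_ge0// => g gs; rewrite mulr_ge0// w0.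
Qed.

End states.

Lemma positive_lower_bound (R : realType) (I : eqType) (s : seq I) (P : pred I)
    (F : I -> R) : (forall i, i \in s -> P i -> 0 < F i) ->
  exists2 b, 0 < b & forall i, i \in s -> P i -> b <= F i.
Proof.
elim: s => [|i s IH] F0; first by exists 1.
have [|b b0 hb] := IH; first by move=> j js; apply: F0; rewrite inE js orbT.
have [Pi|nPi] := boolP (P i); last first.
  by exists b => // j; rewrite inE => /predU1P[->|]; [rewrite (negbTE nPi)|exact: hb].
exists (Num.min b (F i)); first by rewrite lt_min b0 F0 ?mem_head.
move=> j; rewrite inE => /predU1P[-> _|js Pj]; first by rewrite ge_min lexx orbT.
by rewrite ge_min hb.
Qed.

(** Obtained from ln (1 + v) >= v / (1 + v). The quadratic remainder controls a small step of the
    concave maximization below. *)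
Lemma ln1D_ge (R : realType) (v : R) : - 2^-1 <= v -> v - 2 * v ^+ 2 <= ln (1 + v).
Proof.
move=> v0; have v1 : 0 < 1 + v by lra.
apply: (@le_trans _ _ (v / (1 + v))).
  by rewrite ler_pdivlMr//; nra.
rewrite -[1 + v]invrK lnV ?posrE ?invr_gt0// lerNr invrK.
have /le_ln1Dx : -1 < (1 + v)^-1 - 1 by have := invr_gt0 (1 + v); lra.
rewrite subrKC => h; apply: le_trans h _.
by rewrite le_eqVlt; apply/orP; left; apply/eqP; field; rewrite gt_eqF.
Qed.

(** * Dual weights for the maximization over states *)

Section dual.
Context {X : topologicalType} {R : realType}.
Notation T := (Cfun X R).
Variables (A : {linear T -> T}) (n : nat) (mu : {scalar T}) (s : seq T) (c : R).
Hypotheses (x0 : X) (X_compact : compact [set: X]) (A_pos : positive A).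
Hypotheses (mu_state : states mu) (s_ge0 : forall g, g \in s -> cnonneg g).
Hypothesis s_sum : \sum_(g <- s) g = 1.
Hypothesis tau_le : forall m, states m ->
  (\sum_(g <- s) tau_term A n mu m g <= c%:E)%E.
Notation P := (linpow A n).

Let P_pos : positive P. Proof. exact: positive_linpow. Qed.
Let mu_ge0 g : g \in s -> 0 <= mu g. Proof. by move=> gs; apply/mu_state.1/s_ge0. Qed.
Let mu_sum : \sum_(g <- s) mu g = 1.
Proof. by rewrite -linear_sum s_sum mu_state.2. Qed.
Let P_ge0 g x : g \in s -> 0 <= P g x. Proof. by move=> gs; apply/P_pos/s_ge0. Qed.
Let P_sum x : \sum_(g <- s) P g x = P 1 x.
Proof. by rewrite -sum_cfunE -linear_sum s_sum. Qed.

(** The weight of [g0] is not constrained by the bound on the sum, so it can be made large: [t] is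
    chosen with mu(g0) t = |ln K - c|, which brings [ln K], the cost of the weights [K^-1], down to
    at most [c]. *)
Lemma dual_weights_degenerate g0 : g0 \in s -> 0 < mu g0 -> (forall x, P g0 x = 0) ->
  exists a : T -> R, [/\ forall g, 0 < a g,
    forall x, \sum_(g <- s) a g * P g x <= 1 &
    - (\sum_(g <- s) mu g * ln (a g)) <= c].
Proof.
move=> g0s mug0 Pg0; have [B B0 hB] := cfun_bounded (P 1) X_compact.
pose K := B + 1; have K1 : 1 <= K by rewrite lerDr.
have K0 : 0 < K by apply: lt_le_trans K1.
pose t := `|ln K - c| / mu g0.
exists (fun g => if g == g0 then expR t else K^-1); split=> [g|x|].
- by case: ifP => _; rewrite ?expR_gt0 ?invr_gt0.
- apply: (@le_trans _ _ (\sum_(g <- s) K^-1 * P g x)).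
    rewrite big_seq [leRHS]big_seq; apply: ler_sum => g gs.
    by case: eqP => [->|//]; rewrite Pg0 !mulr0.
  rewrite -mulr_sumr P_sum mulrC ler_pdivrMr// mul1r.
  by have := hB x; rewrite ler_norml /K => /andP[]; lra.
- have lnK0 : 0 <= ln K by rewrite ln_ge0.
  apply: (@le_trans _ _ (- (\sum_(g <- s) (- (mu g * ln K) +
      (if g == g0 then mu g0 * t else 0))))).
    rewrite lerN2 big_seq [leRHS]big_seq; apply: ler_sum => g gs.
    case: eqP => [->|_]; last by rewrite addr0 lnV// mulrN.
    by rewrite expRK gerDr oppr_le0 mulr_ge0// mu_ge0.
  rewrite big_split /= sumrN -mulr_suml mu_sum mul1r.
  have tE : mu g0 * t = `|ln K - c| by rewrite /t mulrCA divff ?mulr1// gt_eqF.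
  have : mu g0 * t <= \sum_(g <- s) (if g == g0 then mu g0 * t else 0).
    rewrite (big_rem _ g0s) /= eqxx lerDl sumr_ge0// => g _.
    by case: eqP => // _; rewrite tE.
  by have := ler_norm (ln K - c); rewrite tE; lra.
Qed.

(* Near-maximizers of the concave functional [F] satisfy its first-order optimality
   condition approximately, and the gradient supplies the weights. Mixing with [m0]
   keeps the arguments of the logarithms away from 0. *)
Lemma dual_weights_nondegenerate theta : 0 < theta ->
    (forall g, g \in s -> 0 < mu g -> exists x, 0 < P g x) ->
  exists a : T -> R, [/\ forall g, g \in s -> 0 < a g,
    forall x, \sum_(g <- s) a g * P g x <= expR theta &
    - (\sum_(g <- s) mu g * ln (a g)) <= c + theta].
Proof.
move=> theta0 nd; have [B B0 hB] := cfun_bounded (P 1) X_compact.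
pose K := B + 1; have K1 : 1 <= K by rewrite lerDr.
have K0 : 0 < K by apply: lt_le_trans K1.
have PK g x : g \in s -> P g x <= K.
  move=> gs; apply: (@le_trans _ _ (P 1 x)).
    rewrite -P_sum (big_rem _ gs) /= lerDl big_seq sumr_ge0// => h /mem_rem hs.
    exact: P_ge0.
  by have := hB x; rewrite ler_norml /K => /andP[]; lra.
have mPK m g : states m -> g \in s -> 0 <= m (P g) <= K.
  move=> mst gs; apply/andP; split; first by apply: mst.1 => x; exact: P_ge0.
  rewrite -[leRHS]mulr1 -mst.2 -[K * _]/(K *: _) -linearZ; apply: state_le => // x.
  by rewrite cfunZE/= mulr1; exact: PK.
have [p hp] : exists p : T -> X, forall g, g \in s -> 0 < mu g -> 0 < P g (p g).
  have /choice[p hp] : forall g, exists x, g \in s -> 0 < mu g -> 0 < P g x.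
    move=> g; have [gs|_] := boolP (g \in s); last by exists x0.
    have [/(nd _ gs)[x]|] := boolP (0 < mu g); last by exists x0.
    by exists x.
  by exists p.
(* Point masses at places where the functions [P g] are positive, weighted by [mu], make [m0 (P g)]
   positive whenever [mu g] is. *)
have [m0 m0st m0E] := state_mixture s mu p mu_ge0 mu_sum.
have [b b0 hb] : exists2 b, 0 < b & forall g, g \in s -> 0 < mu g -> b <= m0 (P g).
  apply: positive_lower_bound => g gs mug; rewrite m0E (big_rem _ gs) /=.
  rewrite ltr_pwDl ?mulr_gt0 ?hp// big_seq sumr_ge0// => h /mem_rem hs.
  by rewrite mulr_ge0 ?mu_ge0 ?P_ge0.
(* The factor [q] reappears in the weights and costs exactly [theta] in their logarithms. *)
pose q := expR (- theta); pose t := 1 - q.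
have q0 : 0 < q by exact: expR_gt0.
have q1 : q < 1 by rewrite expR_lt1 oppr_lt0.
have t0 : 0 < t by rewrite subr_gt0.
pose Y (m : {scalar T}) g := q * m (P g) + t * m0 (P g).
have Yb m g : states m -> g \in s -> 0 < mu g -> t * b <= Y m g.
  move=> mst gs mug; rewrite /Y ler_wpDl ?ler_wpM2l ?hb ?(ltW t0)//.
  by rewrite mulr_ge0 ?(ltW q0)//; have /andP[] := mPK m g mst gs.
have tb0 : 0 < t * b by rewrite mulr_gt0.
have Y0 m g : states m -> g \in s -> 0 < mu g -> 0 < Y m g.
  by move=> mst gs mug; exact: lt_le_trans (Yb m g mst gs mug).
have mu_pos g : g \in s -> mu g != 0 -> 0 < mu g.
  by move=> gs mun0; rewrite lt_neqAle eq_sym mun0 mu_ge0.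
pose F m := \sum_(g <- s) mu g * ln (Y m g / mu g).
have Fc m : states m -> F m <= c.
  move=> mst; have [|m' m'st m'E] := state_convex m m0 q t mst m0st (ltW q0) (ltW t0).
    by rewrite /t subrKC.
  rewrite -lee_fin; apply: le_trans (tau_le m' m'st).
  rewrite -sumEFin big_seq [leRHS]big_seq; apply: lee_sum => g gs.
  rewrite /tau_term; have [->|mun0] := eqVneq (mu g) 0; first by rewrite mul0r.
  by rewrite -linpowE m'E -/(Y m g) lne_EFin ?divr_gt0 ?Y0 ?mu_pos.
pose H := 1 + K / (t * b).
have H1 : 1 <= H by rewrite lerDl ltW// divr_gt0.
have H0 : 0 < H by exact: lt_le_trans H1.
pose th := Num.min 1 (theta / 2).
have th0 : 0 < th by rewrite lt_min ltr01 divr_gt0.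
have th1 : th <= 1 by rewrite ge_min lexx.
have th2 : th <= theta / 2 by rewrite ge_min lexx orbT.
(* The step size: it keeps [u * H] at most 1/4, as [ln1D_ge] requires, and with [eta] below it gives
   2 eta = u th. Here [eta] serves both as the slack of the near-maximizer and as a bound on the
   quadratic remainders. *)
pose u := th / (4 * H ^+ 2).
have HH0 : 0 < 4 * H ^+ 2 by rewrite mulr_gt0// exprn_gt0.
have u0 : 0 < u by rewrite divr_gt0.
have uH : u * H <= 4^-1.
  rewrite /u mulrAC ler_pdivrMr// mulrA mulVf// mul1r expr2.
  by rewrite ler_wpM2r ?(ltW H0)// (le_trans th1).
have u1 : u <= 1.
  have : u <= u * H by rewrite ler_peMr// ltW.
  lra.
pose eta := 2 * (u * H) ^+ 2.
have eta0 : 0 < eta by rewrite mulr_gt0// exprn_gt0// mulr_gt0.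
have [m mst mmax] : exists2 m, states m & forall m', states m' -> F m' <= F m + eta.
  pose E := [set F m | m in [set m | states m]].
  have Esup : has_sup E.
    split; first by exists (F m0); exists m0.
    by exists c => _ [m mst <-]; exact: Fc.
  have [_ [m mst <-] mE] := sup_adherent eta0 Esup.
  exists m => // m' m'st.
  have : F m' <= sup E by apply: sup_upper_bound => //; exists m'.
  by lra.
(* The derivative of the logarithm of [Y m g] as [m] moves towards evaluation at [x]; [dsum] is the
   resulting approximate optimality condition. *)
pose d g x := q * (P g x - m (P g)) / Y m g.
have dH g x : g \in s -> 0 < mu g -> `|d g x| <= H.
  move=> gs mug; rewrite /d normrM normrV ?unitfE ?gt_eqF ?Y0//.
  rewrite (gtr0_norm (Y0 _ _ mst gs mug)) normrM (gtr0_norm q0).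
  apply: (@le_trans _ _ (K / (t * b))); last by rewrite lerDr.
  apply: ler_pM.
  - by rewrite mulr_ge0// ltW.
  - by rewrite invr_ge0 ltW// Y0.
  - rewrite -[leRHS]mul1r ler_pM ?(ltW q0) ?(ltW q1)//.
    have /andP[h1 h2] := mPK m g mst gs.
    have := PK g x gs; have := P_ge0 g x gs.
    by rewrite ler_norml => h3 h4; apply/andP; split; lra.
  - by rewrite lef_pV2 ?posrE ?Y0// Yb.
have dsum x : \sum_(g <- s) mu g * d g x <= th.
  have [mx mxst mxE] := @state_eval X R x.
  have [||mu' mu'st mu'E] := state_convex m mx (1 - u) u mst mxst _ (ltW u0).
  - by rewrite subr_ge0.
  - by rewrite subrK.
  have : \sum_(g <- s) (mu g * ln (Y m g / mu g) + (u * (mu g * d g x) - mu g * eta))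
      <= F mu'.
    rewrite /F big_seq [leRHS]big_seq; apply: ler_sum => g gs.
    have [->|mun0] := eqVneq (mu g) 0; first by rewrite !mul0r mulr0 subr0 addr0.
    have mug := mu_pos _ gs mun0.
    have Yg := Y0 _ _ mst gs mug.
    have YE : Y mu' g = Y m g * (1 + u * d g x).
      transitivity (Y m g + u * (q * (P g x - m (P g)))).
        by rewrite /Y mu'E mxE; ring.
      by rewrite /d; field; rewrite gt_eqF.
    have dd : `|u * d g x| <= u * H.
      by rewrite normrM (gtr0_norm u0) ler_wpM2l ?(ltW u0) ?dH.
    have dl : - 2^-1 <= u * d g x by move: dd; rewrite ler_norml => /andP[]; lra.
    have dp : 0 < 1 + u * d g x by lra.
    rewrite YE (mulrAC (Y m g)) [ln (_ * (1 + _))]lnM ?posrE ?divr_gt0// mulrDr lerD2l.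
    rewrite mulrCA -mulrBr ler_wpM2l ?(ltW mug)//.
    apply: le_trans (ln1D_ge _ _ dl); rewrite lerD2l lerN2 /eta ler_wpM2l//.
    by rewrite -real_normK ?num_real// lerXn2r ?nnegrE ?normr_ge0// mulr_ge0// ltW.
  rewrite big_split sumrB /= -/(F m) -mulr_sumr -mulr_suml mu_sum mul1r.
  have := mmax _ mu'st => h1 h2.
  have h3 : u * \sum_(g <- s) mu g * d g x <= 2 * eta by lra.
  have etaE : 2 * eta = u * th.
    have -> : th = u * (4 * H ^+ 2) by rewrite /u -mulrA mulVf ?mulr1// gt_eqF.
    by rewrite /eta; ring.
  by move: h3; rewrite etaE ler_pM2l.
(* This makes the weights positive also where [mu g] vanishes and adds at most [theta / 2] to the
   weighted sum. *)
pose eps := theta / (2 * K).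
have eps0 : 0 < eps by rewrite divr_gt0// mulr_gt0.
exists (fun g => q * mu g / Y m g + eps).
have aq g : g \in s -> 0 <= q * mu g / Y m g.
  move=> gs; have [->|/(mu_pos _ gs) mug] := eqVneq (mu g) 0; first by rewrite mulr0 mul0r.
  by rewrite ltW// divr_gt0 ?mulr_gt0 ?Y0.
split=> [g gs|x|].
- by rewrite ltr_wpDl// aq.
- apply: (@le_trans _ _ (\sum_(g <- s) (mu g * d g x + mu g + eps * P g x))).
    rewrite big_seq [leRHS]big_seq; apply: ler_sum => g gs.
    rewrite mulrDl lerD2r.
    have [->|mun0] := eqVneq (mu g) 0; first by rewrite mulr0 !mul0r add0r.
    have mug := mu_pos _ gs mun0.
    have Yg := Y0 _ _ mst gs mug.
    rewrite [leLHS](_ : _ = mu g * d g x + mu g * (q * m (P g) / Y m g)).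
      rewrite lerD2l ler_piMr ?(ltW mug)// ler_pdivrMr// mul1r lerDl.
      by rewrite mulr_ge0 ?(ltW t0)//; have /andP[] := mPK m0 g m0st gs.
    by rewrite /d; field; rewrite gt_eqF.
  rewrite !big_split /= mu_sum -mulr_sumr P_sum.
  have h1 := dsum x.
  have h2 : eps * P 1 x <= theta / 2.
    apply: (@le_trans _ _ (eps * K)).
      by rewrite ler_wpM2l ?(ltW eps0)//; have := hB x; rewrite ler_norml /K => /andP[]; lra.
    by rewrite /eps invfM mulrA -mulrA mulVf ?mulr1 ?gt_eqF.
  by apply: le_trans (expR_ge1Dx _); lra.
- apply: (@le_trans _ _ (\sum_(g <- s) (mu g * ln (Y m g / mu g) + mu g * theta))).
    rewrite -sumrN big_seq [leRHS]big_seq; apply: ler_sum => g gs.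
    have [->|mun0] := eqVneq (mu g) 0; first by rewrite !mul0r oppr0 addr0.
    have mug := mu_pos _ gs mun0.
    have Yg := Y0 _ _ mst gs mug.
    rewrite -mulrN -mulrDr ler_wpM2l ?(ltW mug)// lerNl.
    have qm : 0 < q * mu g / Y m g by rewrite divr_gt0// mulr_gt0.
    apply: (@le_trans _ _ (ln (q * mu g / Y m g))); last first.
      by rewrite ler_ln ?posrE ?lerDl ?(ltW eps0)// ltr_wpDl// ltW.
    rewrite -mulrA -[mu g / _]invf_div [ln (q * _)]lnM ?posrE ?invr_gt0 ?divr_gt0//.
    rewrite lnV ?posrE ?divr_gt0//.
    by rewrite /q expRK opprD addrC.
  rewrite big_split /= -/(F m) -mulr_suml mu_sum mul1r lerD2r; exact: Fc.
Qed.

Lemma dual_weights theta : 0 < theta ->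
  exists a : T -> R, [/\ forall g, g \in s -> 0 < a g,
    forall x, \sum_(g <- s) a g * P g x <= expR theta &
    - (\sum_(g <- s) mu g * ln (a g)) <= c + theta].
Proof.
move=> theta0.
have [nd|] := pselect (forall g, g \in s -> 0 < mu g -> exists x, 0 < P g x).
  exact: dual_weights_nondegenerate.
move=> /existsNP[g /not_implyP[gs /not_implyP[mug /forallNP Pg]]].
have [|a [a0 aP amu]] := dual_weights_degenerate g gs mug.
  move=> x; apply/eqP; rewrite eq_le P_ge0// andbT leNgt; apply/negP; exact: Pg.
exists a; split=> // [x|]; last by rewrite (le_trans amu)// lerDl ltW.
by rewrite (le_trans (aP x))// -expR0 ler_expR ltW.
Qed.

End dual.

(** * From a bound for one power of the operator to a growth rate *)

Section shift.
Context {X : topologicalType} {R : realType}.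
Notation T := (Cfun X R).
Variables (alpha : continuousType X X) (A : {linear T -> T}).
Hypotheses (X_compact : compact [set: X]).
Hypothesis A_transfer : transfer_operator alpha A.
Notation K := (koopman alpha).

(** The Birkhoff sum of [psi] for the [n]-th iterate of [alpha]. *)
Definition stride_sum (psi : T) n N : T := \sum_(k < N) linpow (K) (k * n) psi.

(** The indices are grouped by their residue modulo [n]. *)
Lemma birkhoff_stride psi n N :
  birkhoff alpha psi (N * n) = \sum_(i < n) linpow (K) i (stride_sum psi n N).
Proof.
elim: N => [|N IH].
  rewrite mul0n /birkhoff big_ord0 big1// => i _.
  by rewrite /stride_sum big_ord0 linear0.
rewrite mulSnr /birkhoff big_split_ord /= -/(birkhoff alpha psi (N * n)) IH.
rewrite -big_split; apply: eq_bigr => i _ /=.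
by rewrite /stride_sum big_ord_recr linearD /= -linpowD addnC.
Qed.

(** The last factor passes through [linpow A (N * n)] as [cexp psi], which leaves one application of
    the hypothesis. *)
Lemma transfer_stride psi n N (c : R) :
    (forall x, linpow A n (cexp psi) x <= expR c) ->
  forall x, linpow A (N * n) (cexp (stride_sum psi n N)) x <= expR (N%:R * c).
Proof.
move=> h; have Apos := transfer_positive alpha A A_transfer.
elim: N => [|N IH] x.
  by rewrite mul0n mul0r /stride_sum big_ord0 /= /cexp/=.
rewrite mulSn linpowD.
have -> : cexp (stride_sum psi n N.+1) =
    linpow (K) (N * n) (cexp psi) * cexp (stride_sum psi n N).
  by rewrite /stride_sum big_ord_recr /= cexpD koopman_exp mulrC.
rewrite (transfer_linpow alpha)//.
apply: (@le_trans _ _ (linpow A n (expR (N%:R * c) *: cexp psi) x)).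
  apply: positive_le; first exact: positive_linpow.
  by move=> y; rewrite cfunME cfunZE mulrC ler_wpM2r ?expR_ge0.
rewrite linearZ cfunZE mulrSr mulrDl mul1r expRD.
by rewrite ler_wpM2l ?expR_ge0.
Qed.

(* Averaging [psi] over [n] consecutive shifts turns a bound for one step of [A^n]
   into a growth rate for [A]; Jensen's inequality separates the shifts. *)
Lemma growth_average (psi : T) n (c e : R) : (0 < n)%N -> 0 < e ->
    (forall x, linpow A n (cexp psi) x <= expR c) ->
  growth alpha (linpow A) (n%:R^-1 *: psi) (c / n%:R + e).
Proof.
move=> n0 e0 h; have Apos := transfer_positive alpha A A_transfer.
have nR : 0 < n%:R :> R by rewrite ltr0n.
have bnd (f : T) : exists B, 0 <= B /\ forall x, f x <= B.
  have [B B0 hB] := cfun_bounded f X_compact.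
  by exists B; split=> // x; exact: le_trans (ler_norm _) (hB x).
have [B hB] := choice (fun i => bnd (linpow A i 1 : T)).
have [B' hB'] := choice (fun i => bnd (linpow A i (cexp psi) : T)).
pose C := n%:R^-1 * \sum_(i < n) B i * B' (n - i)%N.
have main N x : linpow A (N.+1 * n)
    (cexp (birkhoff alpha (n%:R^-1 *: psi) (N.+1 * n))) x <= C * expR (N%:R * c).
  set E := stride_sum psi n N.+1.
  apply: (@le_trans _ _ (linpow A (N.+1 * n)
      (n%:R^-1 *: \sum_(i < n) linpow (K) i (cexp E)) x)).
    apply: positive_le; first exact: positive_linpow.
    move=> y; rewrite birkhoffZ birkhoff_stride -/E /cexp/= cfunZE sum_cfunE.
    rewrite cfunZE sum_cfunE !mulr_sumr.
    under [leRHS]eq_bigr do rewrite koopman_exp.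
    apply: (@jensen_expR R 'I_n (index_enum 'I_n) (fun=> n%:R^-1)
        (fun i => linpow (K) i E y)).
      by move=> i; rewrite invr_ge0 ler0n.
    by rewrite sumr_const card_ord -[RHS](mulVf (lt0r_neq0 nR)) mulr_natr.
  rewrite linearZ cfunZE -mulrA ler_wpM2l ?invr_ge0 ?ler0n//.
  rewrite linear_sum sum_cfunE mulr_suml; apply: ler_sum => i _.
  (* The innermost [i] steps undo the shift by [i] at the cost [B i], the next [N * n] steps consume
     all of [E] except one copy of [psi], and the last [n - i] steps meet that copy at the cost
     [B' (n - i)]. *)
  have iN : (N.+1 * n = (n - i) + (N * n + i))%N.
    by rewrite mulSn addnCA subnK 1?addnC// ltnW.
  rewrite iN !linpowD.
  have [B0 BP] := hB i; have [B'0 BP'] := hB' (n - i)%N.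
  apply: (@le_trans _ _ (linpow A (n - i) (B i *: (expR (N%:R * c) *: cexp psi)) x)).
    apply: positive_le; first exact: positive_linpow.
    move=> y; apply: (@le_trans _ _ (linpow A (N * n) (B i *: cexp E) y)).
      apply: positive_le; first exact: positive_linpow.
      move=> z; rewrite -[linpow (K) i _]mulr1 (transfer_linpow alpha)//.
      by rewrite cfunZE cfunME mulrC ler_wpM2r ?expR_ge0.
    rewrite linearZ !cfunZE ler_wpM2l//.
    have -> : cexp E = linpow (K) (N * n) (cexp psi) * cexp (stride_sum psi n N).
      by rewrite /E /stride_sum big_ord_recr /= cexpD koopman_exp mulrC.
    rewrite (transfer_linpow alpha)// cfunME mulrC ler_wpM2r ?expR_ge0//.
    exact: transfer_stride.
  rewrite !linearZ !cfunZE -[leRHS]mulrA ler_wpM2l// mulrC ler_wpM2r ?expR_ge0//.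
(* One power suffices for [growth_of_power]; this [N] is large enough for [e] to absorb the constant
   [C]. *)
have [N _ hN] := nbhs_infty_ger ((C - c) / e).
apply: (growth_of_power alpha A X_compact A_transfer _ (N.+1 * n)); first by rewrite muln_gt0.
move=> x; rewrite -(weighted_pow alpha A A_transfer); apply: le_trans (main N x) _.
have -> : (N.+1 * n)%:R * (c / n%:R + e) = N%:R * c + (c + (N.+1 * n)%:R * e).
  by rewrite natrM -natr1; field; rewrite gt_eqF.
rewrite expRD mulrC ler_wpM2l ?expR_ge0//.
apply: le_trans (expR_ge1Dx _).
have := hN N (leqnn N); rewrite ler_pdivrMr// => CN.
have NM : N%:R <= (N.+1 * n)%:R :> R.
  by rewrite ler_nat (leq_trans (leqnSn N))// leq_pmulr.
have := ler_wpM2r (ltW e0) NM; lra.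
Qed.
End shift.

(** * The lower bound, the attained maximum and duality *)

Section variational_principle.
Context {X : topologicalType} {R : realType}.
Notation T := (Cfun X R).
Variables (alpha : continuousType X X) (A : {linear T -> T}).
Hypotheses (x0 : X) (X_compact : compact [set: X]).
Hypothesis A_transfer : transfer_operator alpha A.
Notation growth := (growth alpha (linpow A)).
Notation lambda := (spectral_potential A).

Let A_pos : positive A := transfer_positive alpha A A_transfer.
Let An_pos n : positive (linpow A n). Proof. exact: positive_linpow. Qed.
Let lambdaE phi : lambda phi = ereal_inf (EFin @` growth phi).
Proof. exact: (spectral_potentialE alpha). Qed.

Lemma le_t_entropy (mu : {scalar T}) l : states mu ->
  (forall psi r, growth psi r -> l <= r - mu psi) -> (l%:E <= t_entropy A mu)%E.
Proof.
move=> mu_st lP; apply: le_ereal_inf_tmp => _ [n /= n0 <-].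
have nR : 0 < n%:R :> R by rewrite ltr0n.
rewrite lee_pdivlMl//; apply: le_ereal_inf_tmp => _ [D Dpart <-].
have [s us DE] := finite_set_uniq D (let: And3 h _ _ := Dpart in h).
move: Dpart; rewrite DE => /(partition_of_unity_seq _ us)[s0 s1].
rewrite tau_nD_seq//; apply: lee_forall_ge => c hc.
rewrite -EFinM lee_fin; apply/ler_addgt0Pr => e e0.
(* One share of [e] is lost in the dual weights, one in their bound [expR theta], and one in
   [growth_average]. *)
pose theta := e / 3; have theta0 : 0 < theta by rewrite divr_gt0.
have [m mst|a [a0 aP amu]] := dual_weights A n mu s c x0 X_compact A_pos
    mu_st s0 s1 _ theta theta0.
  by apply: le_trans hc; apply: ereal_sup_ubound; exists m.
pose psi : T := \sum_(g <- s) ln (a g) *: g.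
have [|x|] := @growth_average _ _ alpha A X_compact A_transfer psi n theta
    (theta / n%:R) n0; first by rewrite divr_gt0.
  apply: le_trans (aP x).
  have -> : \sum_(g <- s) a g * linpow A n g x = linpow A n (\sum_(g <- s) a g *: g) x.
    by rewrite linear_sum sum_cfunE; apply: eq_bigr => g _; rewrite linearZ.
  apply: positive_le => // y; rewrite /cexp/= /psi !sum_cfunE.
  (* Absolute values are inserted because [jensen_expR] wants weights that are nonnegative at every
     index, not just at members of [s]. *)
  rewrite -[leRHS](_ : \sum_(g <- s) `|g y| * expR (ln (a g)) = _); last first.
    rewrite big_seq [RHS]big_seq; apply: eq_bigr => g gs.
    by rewrite lnK ?posrE ?a0// cfunZE mulrC ger0_norm//; exact: s0.
  rewrite (_ : \sum_(g <- s) _ = \sum_(g <- s) `|g y| * ln (a g)); last first.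
    rewrite big_seq [RHS]big_seq; apply: eq_bigr => g gs.
    by rewrite cfunZE mulrC ger0_norm//; exact: s0.
  apply: jensen_expR => //; rewrite -[RHS]/((1 : T) y) -s1 sum_cfunE.
  by rewrite big_seq [RHS]big_seq; apply: eq_bigr => g gs; rewrite ger0_norm//; exact: s0.
move=> C C0 hC; have /lP : growth (n%:R^-1 *: psi) (theta / n%:R + theta / n%:R).
  by exists C.
rewrite linearZ /= => /(ler_wpM2l (ltW nR)) h; apply: le_trans h _.
have -> : mu psi = \sum_(g <- s) mu g * ln (a g).
  by rewrite linear_sum; apply: eq_bigr => g _; rewrite linearZ/= mulrC.
rewrite [leLHS](_ : _ = 2 * theta - \sum_(g <- s) mu g * ln (a g)).
  by rewrite /theta in amu *; lra.
by field; rewrite gt_eqF.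
Qed.

Lemma growth0_exists : exists r, growth 0 r.
Proof.
have [B B0 hB] := cfun_bounded (weighted A 0 1) X_compact.
exists B; apply: (growth_of_power alpha A X_compact A_transfer 0 1) => // x.
rewrite mul1r /=; apply: le_trans (ler_norm _) _; apply: le_trans (hB x) _.
by apply: le_trans (expR_ge1Dx _); rewrite lerDr.
Qed.

(** With identity operators no negative number is a rate of [0], so a subgradient exists there
    whatever [A] is. *)
Lemma invariant_state_exists : exists mu : {scalar T}, invariant_states alpha mu.
Proof.
pose J (_ : nat) : {linear T -> T} := idfun.
have id_pos n : positive (J n) by [].
have z n : birkhoff alpha (0 : T) n = 0.
  by rewrite /birkhoff big1// => i _; rewrite linear0.
have [||mu [L []]] := @growth_subgradient _ _ alpha J X_compact id_pos 0 0 0.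
- by exists 1 => // n x; rewrite z mulr0 expR0 mulr1 /cexp/= expR0.
- move=> r [C C0 hC]; rewrite leNgt; apply/negP => r0.
  have [N _ hN] := nbhs_infty_ger (C / - r).
  have := hC N x0; rewrite z /cexp/= expR0 => h.
  have := hN N (leqnn N); rewrite ler_pdivrMr ?oppr_gt0// => CN.
  have : expR (N%:R * - r) <= C.
    by rewrite mulrN expRN -[leLHS]mul1r ler_pdivrMr ?expR_gt0.
  by have := expR_ge1Dx (N%:R * - r); lra.
- by exists mu.
Qed.

Lemma t_entropy_le_lambda (mu : {scalar T}) phi : invariant_states alpha mu ->
  ((mu phi)%:E + t_entropy A mu <= lambda phi)%E.
Proof.
move=> inv; rewrite lambdaE; apply: le_ereal_inf_tmp => _ [r gr <-].
rewrite addeC -leeBrDr// -EFinB; exact: (t_entropy_le alpha).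
Qed.

Lemma lambda_attained phi : exists2 mu : {scalar T}, invariant_states alpha mu &
  lambda phi = ((mu phi)%:E + t_entropy A mu)%E.
Proof.
have [r0 g0] := growth0_exists.
have [[l hl]|nol] := pselect (exists l, forall r, growth phi r -> l <= r).
  have [mu [L [inv Lle Lgr muG]]] :=
    @growth_subgradient _ _ alpha _ X_compact An_pos r0 phi l g0 hl.
  exists mu => //.
  have -> : t_entropy A mu = (L - mu phi)%:E.
    apply/eqP; rewrite eq_le; apply/andP; split.
      apply/lee_addgt0Pr => e e0; rewrite -EFinD addrAC.
      exact: (t_entropy_le alpha) (Lgr e e0).
    by apply: le_t_entropy => [|psi r /muG]; [case: inv|lra].
  rewrite -EFinD subrKC lambdaE; apply/eqP; rewrite eq_le; apply/andP; split.
    apply/lee_addgt0Pr => e e0; rewrite -EFinD.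
    by apply: ereal_inf_lbound; exists (L + e) => //; exact: Lgr.
  by apply: le_ereal_inf_tmp => _ [r gr <-]; rewrite lee_fin Lle.
(* If the rates have no lower bound, every real number is one, so lambda(phi) = -oo and the general
   inequality forces equality at any invariant state. *)
have gall r : growth phi r.
  apply: contrapT => ngr; apply: nol; exists r => s gs; rewrite leNgt; apply/negP => sr.
  by apply: ngr; exact: growth_ler (ltW sr) gs.
have [mu inv] := invariant_state_exists.
have lam : lambda phi = -oo%E.
  apply: eq_ninfty => r; rewrite lambdaE.
  by apply: ereal_inf_lbound; exists r => //; exact: gall.
exists mu => //; apply/eqP; rewrite eq_le t_entropy_le_lambda// andbT.
by rewrite lam leNye.
Qed.

Lemma t_entropy_dual (mu : {scalar T}) : invariant_states alpha mu ->
  t_entropy A mu = ereal_inf (range (fun phi => (lambda phi - (mu phi)%:E)%E)).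
Proof.
move=> inv; apply/eqP; rewrite eq_le; apply/andP; split.
  apply: le_ereal_inf_tmp => _ [phi _ <-].
  by rewrite leeBrDr// addeC; exact: t_entropy_le_lambda.
have inf_le psi r : growth psi r ->
    (ereal_inf (range (fun phi => lambda phi - (mu phi)%:E)) <= (r - mu psi)%:E)%E.
  move=> gr; apply: ge_ereal_inf; exists (lambda psi - (mu psi)%:E)%E.
    by exists psi.
  by rewrite EFinB leeB// lambdaE; apply: ereal_inf_lbound; exists r.
have [r0 g0] := growth0_exists.
(* A finite infimum is a bound [l] for [le_t_entropy]; the value +oo is excluded by the rate [r0] of
   [0]. *)
move: inf_le; case: ereal_inf => [l inf_le|/(_ _ _ g0)//|_]; last exact: leNye.
by apply: le_t_entropy => //; case: inv.
Qed.

End variational_principle.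

Theorem theorem5p6 (R : realType) (X : topologicalType)
    (X_nonempty : [set: X] !=set0)
    (X_hausdorff : hausdorff_space X)
    (X_compact : compact [set: X])
    (alpha : continuousType X X)
    (A : {linear Cfun X R -> Cfun X R})
    (A_transfer : transfer_operator alpha A) :
  (forall phi : Cfun X R,
     (exists2 mu : {scalar Cfun X R}, invariant_states alpha mu &
        spectral_potential A phi = ((mu phi)%:E + t_entropy A mu)%E) /\
     (forall mu : {scalar Cfun X R}, invariant_states alpha mu ->
        ((mu phi)%:E + t_entropy A mu <= spectral_potential A phi)%E)) /\
  (forall mu : {scalar Cfun X R}, invariant_states alpha mu ->
     t_entropy A mu =
       ereal_inf (range (fun phi : Cfun X R =>
         (spectral_potential A phi - (mu phi)%:E)%E))).
Proof.
have [x0 _] := X_nonempty.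
split=> [phi|mu inv]; last exact: (t_entropy_dual alpha).
split=> [|mu inv]; first exact: (lambda_attained alpha).
exact: (t_entropy_le_lambda alpha).
Qed.
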